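(* Let $M$ be a possibly non-compact smooth manifold without boundary. Consider the signal-observation model $$dX_t = V_0(X_t)\,dt + \sum_{\alpha=1}^l V_\alpha(X_t)\circ dW_t^\alpha,\qquad dY_t = h(X_t)\,dt + dB_t,$$ with $X_t\in M$, $Y_t\in\mathbb{R}^m$, where the signal $X_t$ is a diffusion process whose generator $L=\frac12\sum_{\alpha=1}^l V_\alpha^2+V_0$ has second-order part that is non-degenerate everywhere on $M$, and $h\colon M\to\mathbb{R}^m$ is smooth. Let $x$ and $y$ be distinct critical points of some component $h^i$ of $h$ that are connected by a gradient flow, i.e. there is a curve $\gamma\colon\mathbb{R}\to M$ satisfying $$\gamma'(t)=(\operatorname{grad} h^i)(\gamma(t))\quad\text{for all }t\in\mathbb{R},\qquad \lim_{t\to-\infty}\gamma(t)=x,\qquad \lim_{t\to+\infty}\gamma(t)=y.$$ Then the estimation algebra $\mathcal{E}$ attached to the signal-observation model is infinite-dimensional as a real vector space.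
   Context: $V_0,\dots,V_l$ are smooth vector fields on $M$, regarded also as first-order differential operators on $C^\infty(M)$; $W^\alpha_t$ are standard one-dimensional Brownian motions, $B_t$ is a standard $m$-dimensional Brownian motion, and $\circ$ denotes Stratonovich integration. All functions and operators are real. Non-degenerate diffusion process: $X_t$ is generated by $L$ in the sense that, for every smooth test function $\phi$, the process $\phi(X_t)-\phi(X_0)-\int_0^t L\phi(X_s)\,ds$ is an adapted martingale, and $L$ is a second-order differential operator with smooth coefficients whose second-order part is everywhere non-degenerate: if in local coordinates the second-order part is $\frac12\sum_{i,j}a_{ij}(x)\partial_i\partial_j$ with $(a_{ij})$ symmetric, then the matrix $(a_{ij}(x))$ is invertible at every $x$. Riemannian metric attached to $L$: $M$ is given the Riemannian metric $g$ whose matrix in local coordinates is $(a_{ij})^{-1}$, so that $L=\frac12\Delta_{M}+F$, where $\Delta_M=\operatorname{div}_g\operatorname{grad}_g$ is the Laplace-Beltrami operator of $g$ and $F$ is a smooth vector field. The gradient $\operatorname{grad}=\operatorname{grad}_g$ is taken with respect to $g$. Let $\omega$ be the Riemannian measure of $g$ and $L^*$ the formal adjoint of $L$ with respect to $\omega$. Estimation algebra: $\mathcal{E}$ is the real Lie subalgebra, under the commutator $[D_1,D_2]=D_1D_2-D_2D_1$, of the algebra of smooth differential operators on $M$ generated by $L_0,L_1,\dots,L_m$, where $L_0=L^*-\frac12 h^\top h$ (the function $h^\top h=\sum_j (h^j)^2$ acting by multiplication) and, for $1\le j\le m$, $L_j$ is multiplication by the $j$-th component $h^j$ of $h$. *)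

(* Defs.v *)
From HB Require Import structures.
From mathcomp Require Import all_boot all_order all_algebra.
From mathcomp Require Import all_classical all_reals all_analysis.

Set Implicit Arguments.
Unset Strict Implicit.
Unset Printing Implicit Defensive.

Import Order.TTheory GRing.Theory Num.Theory.
Import numFieldNormedType.Exports.

Local Open Scope classical_set_scope.
Local Open Scope ring_scope.

Section smooth_on.
Context {R : realType} {n : nat}.
Implicit Types (U : set 'rV[R]_n) (f g : 'rV[R]_n -> R).

Definition basis_vec (i : 'I_n) : 'rV[R]_n := delta_mx ord0 i.

(* Only meant for an open U. *)
Fixpoint Ck_on (k : nat) U f : Prop :=
  (forall x, U x -> {for x, continuous f}) /\
  if k is k'.+1 then
    forall i, (forall x, U x -> derivable f x (basis_vec i)) /\
              Ck_on k' U (fun x => 'D_(basis_vec i) f x)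
  else True.

Definition smooth_on U f : Prop := forall k, Ck_on k U f.

Lemma Ck_onS k U f : Ck_on k.+1 U f -> Ck_on k U f.
Proof.
elim: k f => [|k IH] f /= [cf df]; first by [].
by split=> // i; have [dfi Cfi] := df i; split=> //; exact: IH.
Qed.

Lemma Ck_on_ext k U f g : open U -> (forall x, U x -> f x = g x) ->
  Ck_on k U f -> Ck_on k U g.
Proof.
move=> oU.
have nbhs_fg f' g' x : (forall x, U x -> f' x = g' x) -> U x ->
    {near x, f' =1 g'}.
  move=> fg Ux; near=> y; apply: fg; near: y; exact: open_nbhs_nbhs.
have cont_ext f' g' : (forall x, U x -> f' x = g' x) ->
    (forall x, U x -> {for x, continuous f'}) ->
    forall x, U x -> {for x, continuous g'}.
  move=> fg cf x Ux; rewrite /prop_for /continuous_at -(fg _ Ux).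
  exact: cvg_trans (near_eq_cvg (nbhs_fg _ _ _ fg Ux)) (cf _ Ux).
elim: k f g => [|k IH] f g fg /= [cf df]; split=> //; try exact: cont_ext cf.
move=> i; have [dfi Cfi] := df i.
have ne0 : basis_vec i != 0.
  apply/eqP => /matrixP /(_ ord0 i); rewrite !mxE !eqxx => /eqP.
  by rewrite oner_eq0.
split=> [x Ux|]; first by apply: near_eq_derivable (nbhs_fg _ _ _ fg Ux) (dfi _ Ux).
apply: IH Cfi => x Ux; exact: near_eq_derive (nbhs_fg _ _ _ fg Ux).
Unshelve. all: by end_near.
Qed.

Lemma Ck_on_cst k U (a : R) : open U -> Ck_on k U (fun=> a).
Proof.
move=> oU; elim: k a => [|k IH] a /=; split=> //; try by move=> x _; exact: cst_continuous.
move=> i; split=> [x _|]; first exact: derivable_cst.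
by apply: Ck_on_ext (IH 0) => // x _; rewrite derive_cst.
Qed.

Lemma Ck_onD k U f g : open U -> Ck_on k U f -> Ck_on k U g ->
  Ck_on k U (fun x => f x + g x).
Proof.
move=> oU; elim: k f g => [|k IH] f g /= [cf df] [cg dg]; split=> //;
  try by move=> x Ux; apply: continuousD; [exact: cf|exact: cg].
move=> i; have [dfi Cfi] := df i; have [dgi Cgi] := dg i.
split=> [x Ux|]; first by apply: derivableD; [exact: dfi|exact: dgi].
apply: Ck_on_ext (IH _ _ Cfi Cgi) => // x Ux.
by rewrite -[in RHS]/(f \+ g) deriveD//; [exact: dfi|exact: dgi].
Qed.

Lemma Ck_onM k U f g : open U -> Ck_on k U f -> Ck_on k U g ->
  Ck_on k U (fun x => f x * g x).
Proof.
move=> oU; elim: k f g => [|k IH] f g Cf Cg;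
  have [cf df] := Cf; have [cg dg] := Cg; split=> //;
  try by move=> x Ux; apply: continuousM; [exact: cf|exact: cg].
move=> i; have [dfi Cfi] := df i; have [dgi Cgi] := dg i.
split=> [x Ux|]; first by apply: derivableM; [exact: dfi|exact: dgi].
apply: Ck_on_ext
  (Ck_onD oU (IH _ _ (Ck_onS Cf) Cgi) (IH _ _ (Ck_onS Cg) Cfi)) => // x Ux.
by rewrite -[in RHS]/(f \* g) deriveM//; [exact: dfi|exact: dgi].
Qed.

End smooth_on.

Record chart (R : realType) (n : nat) (M : topologicalType) := Chart {
  chart_dom : set M;
  chart_map : M -> 'rV[R]_n;
  chart_inv : 'rV[R]_n -> M;
  _ : open chart_dom;
  _ : open (chart_map @` chart_dom);
  _ : forall p, chart_dom p -> chart_inv (chart_map p) = p;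
  _ : forall p, chart_dom p -> {for p, continuous chart_map};
  _ : forall v, (chart_map @` chart_dom) v -> {for v, continuous chart_inv}
}.

Definition chart_image (R : realType) n (M : topologicalType)
  (c : chart R n M) : set 'rV[R]_n := chart_map c @` chart_dom c.

(* A smooth manifold of dimension n without boundary, given by an atlas which
   need not be maximal.  The carrier is pointed because the library's
   measurable types are; this only excludes the empty manifold. *)
Record manifold (R : realType) (n : nat) := Manifold {
  manifold_carrier :> ptopologicalType;
  chart_index : Type;
  charts : chart_index -> chart R n manifold_carrier;
  _ : hausdorff_space manifold_carrier;
  _ : @second_countable manifold_carrier;
  _ : forall p, exists c, chart_dom (charts c) p;
  _ : forall c c' j, smooth_on
        (chart_map (charts c) @`
           (chart_dom (charts c) `&` chart_dom (charts c')))
        (fun v => chart_map (charts c') (chart_inv (charts c) v) ord0 j)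
}.

Section smooth_functions.
Context {R : realType} {n : nat} (M : manifold R n).

Definition smooth_in (c : chart_index M) (f : M -> R) : Prop :=
  smooth_on (chart_image (charts c)) (f \o chart_inv (charts c)).

Definition smooth_pred : {pred M -> R} :=
  fun f => `[< forall c, smooth_in c f >].

Lemma smooth_predP f : reflect (forall c, smooth_in c f) (f \in smooth_pred).
Proof. exact: asboolP. Qed.

Lemma open_chart_image (c : chart_index M) : open (chart_image (charts c)).
Proof. by rewrite /chart_image; case: (charts c). Qed.

Lemma smooth_pred_cst (a : R) : (fun=> a) \in smooth_pred.
Proof. apply/smooth_predP => c k; exact/Ck_on_cst/open_chart_image. Qed.

Lemma smooth_predM (f g : M -> R) :
  f \in smooth_pred -> g \in smooth_pred -> f * g \in smooth_pred.
Proof.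
move=> /smooth_predP sf /smooth_predP sg; apply/smooth_predP => c k.
by have := Ck_onM (@open_chart_image c) (sf c k) (sg c k).
Qed.

Lemma smooth_pred_subring : subring_closed smooth_pred.
Proof.
split=> [|f g sf sg|f g]; [exact: smooth_pred_cst| |exact: smooth_predM].
have /smooth_predP sNg := smooth_predM (smooth_pred_cst (-1)) sg.
move: sf => /smooth_predP sf; apply/smooth_predP => c k.
have := Ck_onD (@open_chart_image c) (sf c k) (sNg c k).
apply: Ck_on_ext; first exact: open_chart_image.
by move=> x _ /=; rewrite /GRing.mul/= mulN1r.
Qed.

Lemma smooth_pred_scale (a : R) f : f \in smooth_pred -> a *: f \in smooth_pred.
Proof. by move=> sf; exact: (smooth_predM (smooth_pred_cst a) sf). Qed.

HB.instance Definition _ :=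
  GRing.isSubringClosed.Build (M -> R) smooth_pred smooth_pred_subring.
HB.instance Definition _ :=
  GRing.isScaleClosed.Build R (M -> R) smooth_pred smooth_pred_scale.

Record smooth_fun := SmoothFun {
  smooth_fun_val :> M -> R;
  _ : smooth_fun_val \in smooth_pred }.

HB.instance Definition _ := [isSub for smooth_fun_val].
HB.instance Definition _ := [Choice of smooth_fun by <:].
HB.instance Definition _ := [SubChoice_isSubComNzRing of smooth_fun by <:].
HB.instance Definition _ := [SubZmodule_isSubLmodule of smooth_fun by <:].

End smooth_functions.

Notation "'C^oo' ( M )" := (smooth_fun M) (at level 0, format "'C^oo' ( M )").

Section differential_operators.
Context {R : realType} {n : nat} {M : manifold R n}.
Implicit Types (c : chart_index M) (u f : C^oo(M)) (p : M) (D : C^oo(M) -> C^oo(M)).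

Definition local_repr c (f : M -> R) : 'rV[R]_n -> R := f \o chart_inv (charts c).

Definition partial c (i : 'I_n) (f : M -> R) p : R :=
  'D_(basis_vec i) (local_repr c f) (chart_map (charts c) p).

Definition partial2 c (i j : 'I_n) (f : M -> R) p : R :=
  'D_(basis_vec i) (fun v => 'D_(basis_vec j) (local_repr c f) v)
    (chart_map (charts c) p).

Definition differential c (f : M -> R) p : 'rV[R]_n := \row_i partial c i f p.

Definition critical_point f p : Prop :=
  forall c, chart_dom (charts c) p -> differential c f p = 0.

(* A vector field is given by its action on functions, which is
   sum_i b_i d_i in each chart. *)
Record vector_field := VectorField {
  vector_field_op :> C^oo(M) -> C^oo(M);
  _ : forall c, exists2 b : M -> 'rV[R]_n,
        (forall i, smooth_in c (fun p => b p ord0 i)) &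
        forall f p, chart_dom (charts c) p ->
          vector_field_op f p = \sum_i b p ord0 i * partial c i f p }.

(* The coordinate expression of D in the chart c is
   1/2 sum_ij a_ij d_i d_j + sum_i b_i d_i + e. *)
Definition second_order_part D c (a : M -> 'M[R]_n) : Prop :=
  [/\ forall p, chart_dom (charts c) p -> (a p)^T = a p,
      forall i j, smooth_in c (fun p => a p i j) &
      exists (b : M -> 'rV[R]_n) (e : M -> R),
        [/\ forall i, smooth_in c (fun p => b p ord0 i), smooth_in c e &
        forall f p, chart_dom (charts c) p ->
          D f p = 2^-1 * (\sum_i \sum_j a p i j * partial2 c i j f p)
                  + \sum_i b p ord0 i * partial c i f p + e p * f p]].

(* The matrix a is determined by D on the domain of c. *)
Definition second_order_nondegenerate D : Prop :=
  forall c, exists2 a, second_order_part D c a &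
    forall p, chart_dom (charts c) p -> a p \in unitmx.

Definition generator l (V0 : vector_field) (V : 'I_l -> vector_field) :
    C^oo(M) -> C^oo(M) :=
  2^-1 *: (\sum_alpha (V alpha \o V alpha)) + (V0 : C^oo(M) -> C^oo(M)).

Definition jacobian c c' p : 'M[R]_n :=
  \matrix_(i, j) partial c i (fun q => chart_map (charts c') q ord0 j) p.

Record riemannian_metric := RiemannianMetric {
  metric_mx :> chart_index M -> M -> 'M[R]_n;
  _ : forall c i j, smooth_in c (fun p => metric_mx c p i j);
  _ : forall c p, chart_dom (charts c) p -> (metric_mx c p)^T = metric_mx c p;
  _ : forall c p (v : 'rV[R]_n), chart_dom (charts c) p -> v != 0 ->
        0 < (v *m metric_mx c p *m v^T) ord0 ord0;
  _ : forall c c' p, chart_dom (charts c) p -> chart_dom (charts c') p ->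
        metric_mx c p = jacobian c c' p *m metric_mx c' p *m (jacobian c c' p)^T }.

Definition metric_attached_to D (g : riemannian_metric) : Prop :=
  forall c, exists2 a, second_order_part D c a &
    forall p, chart_dom (charts c) p -> g c p = invmx (a p).

(* Components, in the chart c, of the gradient of f. *)
Definition gradient (g : riemannian_metric) f c p : 'rV[R]_n :=
  differential c f p *m invmx (g c p).

(* Continuity is stated because chart_map takes arbitrary values outside
   chart_dom. *)
Definition gradient_flow_line (g : riemannian_metric) f (gamma : R -> M) : Prop :=
  continuous gamma /\
  forall t c, chart_dom (charts c) (gamma t) ->
    is_derive t 1 (chart_map (charts c) \o gamma) (gradient g f c (gamma t)).

Definition compactly_supported (f : M -> R) : Prop :=
  compact (closure [set p | f p != 0]).

Definition mul_op u : C^oo(M) -> C^oo(M) := fun f => u * f.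

Definition commutator D1 D2 : C^oo(M) -> C^oo(M) := (D1 \o D2) - (D2 \o D1).

(* The bracket closure is taken among all self-maps of C^oo(M); when the
   generators are differential operators it consists of such operators. *)
Inductive lie_subalgebra (S : set (C^oo(M) -> C^oo(M))) :
    (C^oo(M) -> C^oo(M)) -> Prop :=
| lie_gen D : S D -> lie_subalgebra S D
| lie_zero : lie_subalgebra S 0
| lie_add D1 D2 : lie_subalgebra S D1 -> lie_subalgebra S D2 ->
    lie_subalgebra S (D1 + D2)
| lie_scale (k : R) D : lie_subalgebra S D -> lie_subalgebra S (k *: D)
| lie_bracket D1 D2 : lie_subalgebra S D1 -> lie_subalgebra S D2 ->
    lie_subalgebra S (commutator D1 D2).

Definition estimation_algebra m (Lstar : C^oo(M) -> C^oo(M))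
    (h : 'I_m -> C^oo(M)) : set (C^oo(M) -> C^oo(M)) :=
  lie_subalgebra
    ([set Lstar - 2^-1 *: mul_op (\sum_j h j ^+ 2)]
     `|` range (fun j => mul_op (h j))).

End differential_operators.

Arguments vector_field {R n} M.
Arguments riemannian_metric {R n} M.

Definition finite_dimensional (R : realType) (V : lmodType R) (E : set V) : Prop :=
  exists N (b : 'I_N -> V), (forall i, E (b i)) /\
    forall D, E D -> exists k : 'I_N -> R, D = \sum_i k i *: b i.

(* Lebesgue integral on R^n of a nonnegative Borel function, as an iterated
   one-dimensional integral (Tonelli). *)
Fixpoint lebesgue_int (R : realType) (n : nat) : ('rV[R]_n -> \bar R) -> \bar R :=
  match n with
  | 0 => fun f => f 0
  | n'.+1 => fun f =>
      (\int[@lebesgue_measure R]_t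
         lebesgue_int (fun v : 'rV[R]_n' => f (row_mx (t%:M : 'rV[R]_1) v)))%E
  end.

Definition borel (T : ptopologicalType) := g_sigma_algebraType (@open T).

Section riemannian_measure.
Context {R : realType} {n : nat} {M : manifold R n}.

Definition is_riemannian_measure (g : riemannian_metric M)
    (omega : {measure set (borel M) -> \bar R}) : Prop :=
  forall c (A : set (borel M)), measurable A -> A `<=` chart_dom (charts c) ->
    omega A = lebesgue_int (fun v =>
      (\1_(chart_map (charts c) @` A) v *
       Num.sqrt (\det (g c (chart_inv (charts c) v))))%:E).

(* Testing against compactly supported phi and arbitrary psi determines Dstar
   on all of C^oo(M). *)
Definition is_formal_adjoint (omega : {measure set (borel M) -> \bar R})
    (D Dstar : C^oo(M) -> C^oo(M)) : Prop :=
  forall phi psi : C^oo(M), compactly_supported phi ->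
    \int[omega]_p (D phi p * psi p) = \int[omega]_p (phi p * Dstar psi p).

End riemannian_measure.

Section processes.
Context {R : realType} {d : measure_display} {Omega : measurableType d}.
Variable P : probability Omega R.
Implicit Types (F : R -> set (set Omega)).

Definition filtration F : Prop :=
  [/\ forall t, 0 <= t -> sigma_algebra setT (F t),
      forall t, 0 <= t -> F t `<=` measurable &
      forall s t, 0 <= s -> s <= t -> F s `<=` F t].

Definition adapted d' (E : measurableType d') F (Z : R -> Omega -> E) : Prop :=
  forall t A, 0 <= t -> measurable A -> F t (Z t @^-1` A).

Definition martingale F (N : R -> Omega -> R) : Prop :=
  [/\ adapted F N,
      forall t, 0 <= t -> P.-integrable setT (EFin \o N t) &
      forall s t A, 0 <= s -> s <= t -> F s A ->
        \int[P]_(w in A) N t w = \int[P]_(w in A) N s w].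

(* The last clause says that the increments B_t - B_s are independent of F_s
   and have law N(0, (t - s) I_k). *)
Definition brownian_motion F k (B : 'I_k -> R -> Omega -> R) : Prop :=
  [/\ forall j, adapted F (B j),
      forall j, {ae P, forall w, B j 0 w = 0},
      forall j, {ae P, forall w, {within `[0, +oo[, continuous (B j ^~ w)}} &
      forall s t A (C : 'I_k -> set R), 0 <= s -> s < t -> F s A ->
        (forall j, measurable (C j)) ->
        fine (P (A `&` [set w | forall j, C j (B j t w - B j s w)])) =
        fine (P A) * \prod_j fine (normal_prob 0 (Num.sqrt (t - s)) (C j))].

(* I is the Stratonovich integral of Z against W over [0, t], i.e. the limit
   in probability of the trapezoidal sums as the mesh of the partition
   tends to 0. *)
Definition stratonovich_integral (Z W : R -> Omega -> R) (t : R)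
    (I : Omega -> R) : Prop :=
  forall eps eta : R, 0 < eps -> 0 < eta ->
  exists2 delta : R, 0 < delta &
  forall N (tau : nat -> R), tau 0 = 0 -> tau N = t ->
    (forall i, (i < N)%N -> tau i <= tau i.+1 <= tau i + delta) ->
    (P [set w | (eps <
       `| \sum_(i < N) (Z (tau i) w + Z (tau i.+1) w) / 2 *
            (W (tau i.+1) w - W (tau i) w) - I w |)%R ] <= eta%:E)%E.

Context {n : nat} {M : manifold R n}.

Definition continuous_adapted F (X : R -> Omega -> M) : Prop :=
  adapted F (X : R -> Omega -> borel M) /\
  {ae P, forall w, {within `[0, +oo[, continuous (X ^~ w)}}.

(* The equation on M is tested against all smooth functions. *)
Definition stratonovich_solution l (V0 : vector_field M)
    (V : 'I_l -> vector_field M) (W : 'I_l -> R -> Omega -> R)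
    (X : R -> Omega -> M) : Prop :=
  forall (f : C^oo(M)) (t : R), 0 <= t ->
  exists2 I : 'I_l -> Omega -> R,
    (forall alpha, measurable_fun setT (I alpha) /\
       stratonovich_integral (fun s w => V alpha f (X s w)) (W alpha) t (I alpha)) &
    {ae P, forall w, f (X t w) - f (X 0 w) =
       (\int[lebesgue_measure]_(s in `[0, t]) V0 f (X s w)) +
       \sum_alpha I alpha w}.

Definition diffusion_generated_by F (L : C^oo(M) -> C^oo(M))
    (X : R -> Omega -> M) : Prop :=
  forall phi : C^oo(M), compactly_supported phi ->
    martingale F (fun t w => phi (X t w) - phi (X 0 w) -
      (\int[lebesgue_measure]_(s in `[0, t]) L phi (X s w))).

Definition observation m (h : 'I_m -> C^oo(M)) (B : 'I_m -> R -> Omega -> R)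
    (X : R -> Omega -> M) (Y : 'I_m -> R -> Omega -> R) : Prop :=
  forall j t, 0 <= t ->
    {ae P, forall w, Y j t w - Y j 0 w =
       (\int[lebesgue_measure]_(s in `[0, t]) h j (X s w)) + B j t w}.

Definition signal_observation_model l m (V0 : vector_field M)
    (V : 'I_l -> vector_field M) (h : 'I_m -> C^oo(M)) F
    (W : 'I_l -> R -> Omega -> R) (B : 'I_m -> R -> Omega -> R)
    (X : R -> Omega -> M) (Y : 'I_m -> R -> Omega -> R) : Prop :=
  [/\ filtration F,
      forall alpha, brownian_motion F (fun _ : 'I_1 => W alpha),
      brownian_motion F B,
      continuous_adapted F X &
      [/\ stratonovich_solution V0 V W X,
          diffusion_generated_by F (generator V0 V) X &
          observation h B X Y]].

End processes.

(* Main.v *)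
Require Import Defs.
From HB Require Import structures.
From mathcomp Require Import all_boot all_order all_algebra.
From mathcomp Require Import all_classical all_reals all_analysis.
From mathcomp Require Import ring lra.

Set Implicit Arguments.
Unset Strict Implicit.
Unset Printing Implicit Defensive.

Import Order.TTheory GRing.Theory Num.Theory.
Import numFieldNormedType.Exports.
From mathcomp Require Import complex.

Local Open Scope classical_set_scope.
Local Open Scope ring_scope.

(** Write f for the component h^i and L for the generator.  For every smooth u
    the double commutator [[L, f], u] is multiplication by the function
    Gamma(f, u) = sum_jk a_jk (d_j f)(d_k u), which is the derivative of u along
    grad f (second_order_double_commutator, differential_carre).  Integration by
    parts turns [[L^*, f], u] into the formal adjoint of [[L, f], u], so it is
    multiplication by the same function (adjoint_double_commutator), and the
    potential term of L_0 commutes with multiplications.  Hence the estimation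
    algebra contains multiplication by every f_k, where f_0 = f and
    f_{k+1} = Gamma(f, f_k).

    Along the flow line, phi_k = f_{k+1} o gamma satisfies phi_k' = phi_{k+1} by
    the chain rule (is_derive_gradient_flow), and each phi_k tends to 0 at both
    ends because Gamma(f, .) vanishes at critical points of f.  If the algebra
    had finite dimension, the phi_k would satisfy a nontrivial linear relation,
    that is, phi_0 would solve a linear equation with constant coefficients.
    A solution all of whose derivatives decay at -oo and at +oo is 0: factor the
    characteristic polynomial over the complex numbers, and observe that a
    solution of psi' = z psi has a monotone modulus (linear_relation_vanish).
    So phi_0 = |grad f|^2 vanishes along gamma, gamma is constant, and x = y.

    The identity for L^* comes from testing against bump functions: a smooth
    function is determined by its integrals against test functions supported in
    small coordinate boxes (test_function_Rintegral_eq).  This uses that a bump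
    function read in any chart is smooth (bump_exists) and that small coordinate
    balls have positive finite Riemannian volume (chart_ball_volume). *)

(** * Differentiability of C^1 functions and the chain rule along curves *)

Lemma is_derive_line (R : realType) (V W : normedModType R) (H : V -> W)
    (y e : V) (s : R) (l : W) :
  is_derive (y + s *: e) e H l <-> is_derive s 1 (fun r => H (y + r *: e)) l.
Proof.
suff E :
    (fun h => h^-1 *: ((H \o shift (y + s *: e)) (h *: e) - H (y + s *: e))) =
    (fun h => h^-1 *: (((fun r => H (y + r *: e)) \o shift s) (h *: 1)
                       - H (y + s *: e))).
  split=> -[d1 d2]; split; move: d1 d2; rewrite /derivable /derive ?E -?E //.
apply/funext => h /=; congr (_ *: (H _ - _)).
by rewrite [h%:A]mulr1 scalerDl addrCA.
Qed.

(** Only the one-dimensional chain rule is needed here: a directional derivative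
    is the derivative of the restriction to a line. *)
Lemma is_derive_scalar_comp (R : realType) (V : normedModType R) (b : R -> R)
    (f : V -> R) (x e : V) (db df : R) :
  is_derive (f x) 1 b db -> is_derive x e f df ->
  is_derive x e (b \o f) (db * df).
Proof.
move=> Db; rewrite -[x in is_derive x](addr0 x) -(scale0r e) => Df.
apply/is_derive_line; move/is_derive_line : Df => Df.
apply: (@is_derive1_comp _ b (fun r => f (x + r *: e))) => //.
by rewrite scale0r addr0.
Qed.


Section C1_differentiable.
Context {R : realType} {n : nat}.
Implicit Types (U : set 'rV[R]_n) (H : 'rV[R]_n -> R).

Lemma norm_coord_le (v : 'rV[R]_n) j : `|v ord0 j| <= `|v|.
Proof.
rewrite [leRHS]/Num.norm/= mx_normrE.
exact: (le_bigmax _ (fun i => `|v i.1 i.2|) (ord0, j)).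
Qed.

Lemma norm_rV_le (v : 'rV[R]_n) (r : R) : 0 <= r ->
  (forall j, `|v ord0 j| <= r) -> `|v| <= r.
Proof.
move=> r0 vr; rewrite [leLHS]/Num.norm/= mx_normrE.
by apply: bigmax_le => // -[i j] _; rewrite (ord1 i)/=.
Qed.

Lemma norm_rV_lt (v : 'rV[R]_n) (r : R) : 0 < r ->
  (`|v| < r) = [forall j, `|v ord0 j| < r].
Proof.
move=> r0; apply/idP/forallP => [vr j|vr].
  exact: le_lt_trans (norm_coord_le v j) vr.
apply: (@le_lt_trans _ _ (\big[Num.max/0]_j `|v ord0 j|)).
  apply: norm_rV_le => [|j]; first exact: bigmax_ge_id.
  exact: (le_bigmax _ (fun j => `|v ord0 j|)).
exact: bigmax_lt.
Qed.

Let trunc k (v : 'rV[R]_n) : 'rV[R]_n :=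
  \row_j (if (j < k)%N then v ord0 j else 0).

Let norm_truncD (k : 'I_n) v (r : R) : 0 <= r <= 1 ->
  `|trunc k v + r *: (v ord0 k *: basis_vec k)| <= `|v|.
Proof.
move=> /andP[r0 r1]; apply: norm_rV_le => // j; rewrite !mxE eqxx/=.
have [->|_] /= := eqVneq j k.
  rewrite ltnn add0r mulr1 normrM (ger0_norm r0).
  by rewrite (le_trans _ (norm_coord_le v k))// ler_piMl.
by rewrite !mulr0 addr0; case: ifP; rewrite ?normr0// norm_coord_le.
Qed.

Let truncS (k : 'I_n) v :
  trunc k.+1 v = trunc k v + 1 *: (v ord0 k *: basis_vec k).
Proof.
apply/rowP => j; rewrite scale1r !mxE eqxx/= ltnS leq_eqVlt.
have [->|jk] := eqVneq j k; first by rewrite eqxx/= ltnn add0r mulr1.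
by rewrite (negbTE (jk : (j != k :> nat))) /= mulr0 addr0.
Qed.

Let nbhs0_lt_ball (d : R) : 0 < d -> \forall v \near (0 : 'rV[R]_n), `|v| < d.
Proof.
move=> d0; apply/nbhs_ballP; exists d => // v.
by rewrite -ball_normE/= sub0r normrN.
Qed.

(* The increment of H is split into increments along the coordinate axes, one
   coordinate of v at a time (trunc k v keeps the first k of them); the mean
   value theorem applies to each. *)
Let C1_estimate U H x (e : R) : open U -> Ck_on 1 U H -> U x -> 0 < e ->
  \forall v \near (0 : 'rV[R]_n),
    `|H (v + x) - H x - \sum_i v ord0 i * 'D_(basis_vec i) H x|
      <= n%:R * e * `|v|.
Proof.
move=> oU /= [cH dH] Ux e0.
have Q : \forall y \near x, U y /\
    forall i, `|'D_(basis_vec i) H x - 'D_(basis_vec i) H y| <= e.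
  have W i : \forall y \near x,
      `|'D_(basis_vec i) H x - 'D_(basis_vec i) H y| <= e.
    have [_ [cD _]] := dH i.
    by have /cvgrPdist_le := cD _ Ux; apply.
  apply: filterS2 (open_nbhs_nbhs (conj oU Ux)) (filter_forall _ W) => //.
have /nbhs_ballP[d /= d0 dQ] := Q.
near=> v.
have vd : `|v| < d by near: v; exact: nbhs0_lt_ball.
have bQ (y : 'rV[R]_n) : `|y| <= `|v| -> U (x + y) /\
    forall i, `|'D_(basis_vec i) H x - 'D_(basis_vec i) H (x + y)| <= e.
  move=> yv; apply: dQ; rewrite -ball_normE/= opprD addrA subrr sub0r normrN.
  exact: le_lt_trans vd.
suff S (k : nat) : (k <= n)%N ->
    `|H (x + trunc k v) - H x -
      \sum_(i < n | (i < k)%N) v ord0 i * 'D_(basis_vec i) H x|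
      <= k%:R * e * `|v|.
  have truncE : trunc n v = v by apply/rowP => j; rewrite mxE ltn_ord.
  have := S n (leqnn n); rewrite truncE [x + v]addrC; congr (`|_ - _| <= _).
  by apply: eq_bigl => i; rewrite ltn_ord.
elim: k => [_|k IH kn].
  rewrite (_ : trunc 0 v = 0); last by apply/rowP => j; rewrite !mxE.
  by rewrite addr0 big_pred0// subrr subr0 normr0 !mul0r.
pose k' := Ordinal kn.
have -> : \sum_(i < n | (i < k.+1)%N) v ord0 i * 'D_(basis_vec i) H x =
   v ord0 k' * 'D_(basis_vec k') H x +
   \sum_(i < n | (i < k)%N) v ord0 i * 'D_(basis_vec i) H x.
  rewrite (bigD1 k')//=; congr (_ + _); apply: eq_bigl => i.
  by rewrite ltnS -val_eqE/= andbC [RHS]ltn_neqAle.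
pose y (s : R) : 'rV[R]_n := trunc k v + s *: (v ord0 k' *: basis_vec k').
pose dF (s : R) : R := 'D_(basis_vec k') H (x + y s) * v ord0 k'.
have yv (s : R) : 0 <= s <= 1 -> `|y s| <= `|v| by exact: (@norm_truncD k').
have DF (s : R) : 0 <= s <= 1 -> is_derive s 1 (fun s => H (x + y s)) (dF s).
  move=> s01.
  have [Uy _] := bQ _ (yv _ s01).
  have := derivableP (proj1 (dH k') _ Uy); rewrite {1}/y.
  rewrite scalerA addrA => /is_derive_line D1.
  have D2 : is_derive s 1 (fun s : R => s * v ord0 k') (v ord0 k').
    have -> : (fun s : R => s * v ord0 k') = (fun s : R => v ord0 k' *: s).
      by apply/funext => z; rewrite mulrC.
    by rewrite -[X in is_derive _ _ _ X]mulr1; exact: is_deriveZ.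
  have := @is_derive1_comp _ (fun r => H (x + trunc k v + r *: basis_vec k'))
    (fun s : R => s * v ord0 k') s _ _ D1 D2; rewrite /comp /dF /y.
  congr (is_derive _ _ _ _).
  by apply/funext => z; rewrite scalerA addrA.
have [c c01 Hc] : exists2 c, c \in `[0, 1]%R &
    H (x + y 1) - H (x + y 0) = dF c * (1 - 0).
  apply: (@MVT_segment _ (fun s => H (x + y s)) dF 0 1) => // [s|].
    by rewrite in_itv/= => /andP[/ltW s0 /ltW s1]; apply: DF; rewrite s0 s1.
  apply: derivable_within_continuous => s; rewrite in_itv/= => s01.
  by have [] := DF s s01.
have {}c01 : 0 <= c <= 1 by move: c01; rewrite in_itv.
rewrite -[k.+1]/(k'.+1) truncS -/(y 1).
move: Hc; rewrite {2}/y scale0r addr0 subr0 mulr1 => Hc.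
have -> : H (x + y 1) - H x - (v ord0 k' * 'D_(basis_vec k') H x +
     \sum_(i < n | (i < k)%N) v ord0 i * 'D_(basis_vec i) H x) =
   (H (x + trunc k v) - H x -
    \sum_(i < n | (i < k)%N) v ord0 i * 'D_(basis_vec i) H x)
   - v ord0 k' * ('D_(basis_vec k') H x - 'D_(basis_vec k') H (x + y c)).
  by rewrite -[H (x + y 1)](subrK (H (x + trunc k v))) Hc /dF; ring.
rewrite (le_trans (ler_normB _ _))// -natr1 !mulrDl lerD//.
  exact: IH (ltnW kn).
rewrite mul1r normrM mulrC ler_pM ?norm_coord_le//.
by have [_] := bQ _ (yv _ c01); apply.
Unshelve. all: by end_near.
Qed.

(** Smoothness is stated with partial derivatives in the basis directions; the
    derivative along an arbitrary curve requires the total derivative. *)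
Lemma C1_differentiable U H x : open U -> Ck_on 1 U H -> U x ->
  differentiable H x /\
  forall v, 'd H x v = \sum_i v ord0 i * 'D_(basis_vec i) H x.
Proof.
move=> oU CH Ux.
pose d (v : 'rV[R]_n) : R := \sum_i v ord0 i * 'D_(basis_vec i) H x.
have lin_d : linear d.
  move=> k u v; rewrite /d scaler_sumr -big_split/=; apply: eq_bigr => i _.
  by rewrite !mxE mulrDl [_ *: _]mulrA.
pose dM := GRing.isLinear.Build _ _ _ _ _ lin_d.
pose dL : {linear 'rV[R]_n -> R} := HB.pack d dM.
have dc : continuous dL.
  apply: (@continuous_big _ _ +%R 0); first exact: add_continuous.
  move=> i _ v; apply: (@cvgM _ _ (nbhs v) _ (fun u => u ord0 i) (fun=> _)).
    exact: coord_continuous.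
  exact: cvg_cst.
have dHE : H \o shift x = cst (H x) + dL +o_ (0 : 'rV[R]_n) id.
  apply/eqaddoP => e e0.
  have e1 : 0 < e / n.+1%:R by rewrite divr_gt0.
  have := C1_estimate oU CH Ux e1; apply: filterS => v /=.
  rewrite -[X in _ -> `|X| <= _]/(H (v + x) - (H x + d v)) opprD addrA.
  move=> /le_trans; apply; apply: ler_wpM2r => //.
  by rewrite mulrCA ler_piMr ?ltW// ltr_pdivrMr// mul1r ltr_nat.
have dE := diff_unique dc dHE.
split; last by move=> v; rewrite dE.
by apply/diff_locallyP; rewrite dE.
Qed.

Lemma is_derive_curve U H (k : R -> 'rV[R]_n) (t : R) (w : 'rV[R]_n) :
  open U -> Ck_on 1 U H -> U (k t) -> is_derive t 1 k w ->
  is_derive t 1 (H \o k) (\sum_i w ord0 i * 'D_(basis_vec i) H (k t)).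
Proof.
move=> oU CH Ux [dk wE].
have [dH dHE] := C1_differentiable oU CH Ux.
have dk' : differentiable k t by exact/derivable1_diffP.
have dHk := differentiable_comp dk' dH.
split; first exact: diff_derivable.
by rewrite deriveE// diff_comp//= dHE -wE deriveE.
Qed.

End C1_differentiable.

(** * Linear equations with constant coefficients and decaying solutions *)

Section decaying_solutions.
Context {R : realType}.

Lemma nondecreasing_cvgy0_le0 (E : R -> R) :
  {homo E : s t / s <= t} -> E t @[t --> +oo] --> 0 -> forall t, E t <= 0.
Proof.
move=> ndE E0 t; rewrite leNgt; apply/negP => Et.
have /cvgrPdist_lt/(_ _ Et) H := E0.
near (pinfty_nbhs R) => s.
have ts : t <= s by near: s; apply: nbhs_pinfty_ge; exact: num_real.
have : `|0 - E s| < E t by near: s.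
rewrite sub0r normrN ltNge => /negP; apply.
by rewrite (le_trans (ndE _ _ ts))// ler_norm.
Unshelve. all: by end_near. Qed.

Lemma nonincreasing_cvgNy0_le0 (E : R -> R) :
  {homo E : s t /~ s <= t} -> E t @[t --> -oo] --> 0 -> forall t, E t <= 0.
Proof.
move=> niE E0 t; rewrite leNgt; apply/negP => Et.
have /cvgrPdist_lt/(_ _ Et) H := E0.
near (ninfty_nbhs R) => s.
have ts : s <= t by near: s; apply: nbhs_ninfty_le; exact: num_real.
have : `|0 - E s| < E t by near: s.
rewrite sub0r normrN ltNge => /negP; apply.
by rewrite (le_trans (niE _ _ ts))// ler_norm.
Unshelve. all: by end_near. Qed.

Lemma homo_le_derive1_ge0 (E dE : R -> R) :
  (forall t : R, is_derive t 1 E (dE t)) -> (forall t, 0 <= dE t) ->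
  {homo E : s t / s <= t}.
Proof.
move=> DE dE0 s t st.
have [|c _ Ec] := @MVT_segment _ E dE s t st (fun x _ => DE x).
  by apply: derivable_within_continuous => x _; case: (DE x).
by rewrite -subr_ge0 Ec mulr_ge0// subr_ge0.
Qed.

(** With psi = u + iv and z = a + ib the two equations say psi' = z psi.  Then
    |psi|^2 has derivative 2a |psi|^2, so it is monotone, and its limit is 0 at
    the end at which it is largest. *)
Lemma spiral_vanish (u v : R -> R) (a b : R) :
  (forall t : R, is_derive t 1 u (a * u t - b * v t)) ->
  (forall t : R, is_derive t 1 v (a * v t + b * u t)) ->
  u t @[t --> -oo] --> 0 -> v t @[t --> -oo] --> 0 ->
  u t @[t --> +oo] --> 0 -> v t @[t --> +oo] --> 0 ->
  forall t, u t = 0 /\ v t = 0.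
Proof.
move=> du dv uN vN uP vP.
pose E t := u t * u t + v t * v t.
have EN : E t @[t --> -oo] --> 0.
  have := cvgD (cvgM uN uN) (cvgM vN vN); rewrite mulr0 addr0; exact.
have EP : E t @[t --> +oo] --> 0.
  have := cvgD (cvgM uP uP) (cvgM vP vP); rewrite mulr0 addr0; exact.
have dE (t : R) : is_derive t 1 E (2 * a * E t).
  have D := is_deriveD (is_deriveM (du t) (du t)) (is_deriveM (dv t) (dv t)).
  apply: (is_derive_eq D); rewrite /E -![_ *: _]/(_ * _) /=; ring.
have E_ge0 t : 0 <= E t by rewrite addr_ge0// -expr2 sqr_ge0.
suff E_le0 t : E t <= 0.
  move=> t; have /eqP := le_anti (introT andP (conj (E_le0 t) (E_ge0 t))).
  rewrite /E paddr_eq0 -?expr2 ?sqr_ge0// !sqrf_eq0 => /andP[/eqP-> /eqP->].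
  by [].
have [a0|/ltW a0] := leP 0 a.
  apply: nondecreasing_cvgy0_le0 EP t.
  by apply: homo_le_derive1_ge0 dE _ => t; rewrite !mulr_ge0.
apply: nonincreasing_cvgNy0_le0 EN t => s r sr.
have dNE (t : R) : is_derive t 1 (\- E) (- (2 * a * E t)) by exact: is_deriveN.
rewrite -lerN2; apply: (homo_le_derive1_ge0 dNE) => // t.
by rewrite -mulNr mulr_ge0// -mulrN mulr_ge0// oppr_ge0.
Qed.

Local Open Scope complex_scope.

(* With f k the k-th derivative of f 0, act f p is p(d/dt) applied to f 0. *)
Let act (f : nat -> R -> R) (p : {poly R[i]}) (t : R) : R[i] :=
  \sum_(k < size p) p`_k * (f k t)%:C.

Let act_widen f (p : {poly R[i]}) N t : (size p <= N)%N ->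
  act f p t = \sum_(k < N) p`_k * (f k t)%:C.
Proof.
move=> pN; rewrite /act (big_ord_widen N (fun k => p`_k * (f k t)%:C) pN).
rewrite big_mkcond/=; apply: eq_bigr => k _; case: ltnP => // kp.
by rewrite nth_default// mul0r.
Qed.

Let act_XsubC f (p : {poly R[i]}) z t :
  act f (p * ('X - z%:P)) t = act (fun k => f k.+1) p t - z * act f p t.
Proof.
rewrite mulrBr (@act_widen _ _ (size p).+1); last first.
  rewrite (leq_trans (size_polyD _ _))// geq_max size_polyN.
  rewrite (leq_trans (size_polyMleq _ _)) ?size_polyX ?addn2//=.
  rewrite (leq_trans (size_polyMleq _ _))// size_polyC.
  by case: eqP; rewrite ?addn1 ?addn0//= ltnW// ltnS leq_pred.
rewrite [act f p t](@act_widen _ _ (size p).+1)//.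
under eq_bigr do rewrite coefB mulrBl coefMX coefMC.
rewrite sumrB; congr (_ - _).
  by rewrite big_ord_recl/= mul0r add0r.
by rewrite mulr_sumr; apply: eq_bigr => k _; rewrite mulrAC mulrC mulrA.
Qed.

(** If p = q (X - z), then q(d/dt) f solves psi' = z psi and decays at both ends,
    so q(d/dt) f = 0: each root of p can be removed in turn. *)
Lemma constant_coefficients_vanish (f : nat -> R -> R) (p : {poly R[i]}) :
  (forall k (t : R), is_derive t 1 (f k) (f k.+1 t)) ->
  (forall k, f k t @[t --> -oo] --> 0) -> (forall k, f k t @[t --> +oo] --> 0) ->
  p != 0 -> (forall t, \sum_(k < size p) p`_k * (f k t)%:C = 0) ->
  forall t, f 0 t = 0.
Proof.
move=> df fN fP.
have ReM (z : R[i]) (r : R) : Re (z * r%:C) = Re z * r.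
  by case: z => x y /=; rewrite mulr0 subr0.
have ImM (z : R[i]) (r : R) : Im (z * r%:C) = Im z * r.
  by case: z => x y /=; rewrite mulr0 add0r.
have Re_act g (q : {poly R[i]}) t :
    Re (act g q t) = \sum_(k < size q) Re q`_k * g k t.
  by rewrite /act raddf_sum; apply: eq_bigr => k _ /=; rewrite ReM.
have Im_act g (q : {poly R[i]}) t :
    Im (act g q t) = \sum_(k < size q) Im q`_k * g k t.
  by rewrite /act raddf_sum; apply: eq_bigr => k _ /=; rewrite ImM.
have dsum N (c : nat -> R) (t : R) :
    is_derive t 1 (fun t => \sum_(k < N) c k * f k t)
    (\sum_(k < N) c k * f k.+1 t).
  have := @is_derive_sum _ _ _ N (fun k t => c k * f k t) t 1
    (fun k => c k * f k.+1 t).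
  rewrite (_ : \sum_(i < N) _ = fun t => \sum_(k < N) c k * f k t); last first.
    by apply/funext => s; rewrite fct_sumE.
  by apply => k; exact: is_deriveZ.
have cvgsum (F : set_system R) N (c : nat -> R) : Filter F ->
    (forall k, f k t @[t --> F] --> 0) ->
    \sum_(k < N) c k * f k t @[t --> F] --> 0.
  move=> FF cF; elim: N => [|N IH].
    by under eq_fun do rewrite big_ord0; exact: cvg_cst.
  under eq_fun do rewrite big_ord_recr/=.
  have := cvgD IH (cvgM (cvg_cst (c N)) (cF N)); rewrite mulr0 addr0; exact.
have [N] := ubnP (size p); elim: N p => // N IH p pN p0 actp.
have [p1|/closed_rootP[z]] := eqVneq (size p) 1.
  move=> t; have := actp t.
  move/eqP: p1 => /size_poly1P[c c0 ->]; rewrite size_polyC c0 big_ord1 coefC/=.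
  by move=> /eqP; rewrite mulf_eq0 (negbTE c0)/= => /eqP[].
move=> /factor_theorem[q pE].
have q0 : q != 0 by apply: contraNneq p0 => q0; rewrite pE q0 mul0r.
have szq : (size q < size p)%N.
  by rewrite pE size_Mmonic ?monicXsubC// size_XsubC addn2.
have qE (t : R) : act (fun k => f k.+1) q t = z * act f q t.
  by apply/eqP; rewrite -subr_eq0 -act_XsubC -pE; apply/eqP; exact: actp.
apply: (IH q) => //; first exact: leq_trans szq _.
move=> t; rewrite -/(act f q t).
have [||||||u0 v0] := @spiral_vanish (fun t => Re (act f q t))
  (fun t => Im (act f q t)) (Re z) (Im z) _ _ _ _ _ _ t.
- move=> s.
  have -> : Re z * Re (act f q s) - Im z * Im (act f q s) =
      Re (z * act f q s).
    by case: (z) => x y; case: (act f q s).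
  rewrite -qE Re_act; under eq_fun do rewrite Re_act.
  exact: (dsum _ (fun k => Re q`_k)).
- move=> s.
  have -> : Re z * Im (act f q s) + Im z * Re (act f q s) =
      Im (z * act f q s).
    by case: (z) => x y; case: (act f q s).
  rewrite -qE Im_act; under eq_fun do rewrite Im_act.
  exact: (dsum _ (fun k => Im q`_k)).
- by under eq_fun do rewrite Re_act; exact: (cvgsum _ _ (fun k => Re q`_k)).
- by under eq_fun do rewrite Im_act; exact: (cvgsum _ _ (fun k => Im q`_k)).
- by under eq_fun do rewrite Re_act; exact: (cvgsum _ _ (fun k => Re q`_k)).
- by under eq_fun do rewrite Im_act; exact: (cvgsum _ _ (fun k => Im q`_k)).
by move: u0 v0; case: (act f q t) => x y /= -> ->.
Qed.

(** A finite linear relation between the successive derivatives of a function is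
    a linear differential equation with constant coefficients. *)
Lemma linear_relation_vanish (f : nat -> R -> R) N (k : 'rV[R]_N) :
  (forall j (t : R), is_derive t 1 (f j) (f j.+1 t)) ->
  (forall j, f j t @[t --> -oo] --> 0) -> (forall j, f j t @[t --> +oo] --> 0) ->
  k != 0 -> (forall t, \sum_(j < N) k ord0 j * f j t = 0) ->
  forall t, f 0 t = 0.
Proof.
move=> df fN fP k0 rel.
pose c (j : nat) : R := if insub j is Some i then k ord0 i else 0.
have cE (i : 'I_N) : c i = k ord0 i by rewrite /c valK.
pose p : {poly R[i]} := \poly_(j < N) (c j)%:C.
apply: (@constant_coefficients_vanish f p) => // [|t].
  apply: contraNneq k0 => p0; apply/eqP/rowP => i; rewrite mxE -cE.
  have := coef0 R[i] i; rewrite -p0 coef_poly ltn_ord => -[].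
  exact.
rewrite -/(act f p t) (@act_widen _ _ N) ?size_poly//.
under eq_bigr do rewrite coef_poly ltn_ord cE -rmorphM/=.
by rewrite -rmorph_sum/= rel.
Qed.

End decaying_solutions.

(** * Smooth functions on open subsets of R^n *)

Section smooth_calculus.
Context {R : realType} {n : nat}.
Implicit Types (U : set 'rV[R]_n) (f g : 'rV[R]_n -> R).

Lemma Ck_on_sub k U U' f : U' `<=` U -> Ck_on k U f -> Ck_on k U' f.
Proof.
move=> UU; elim: k f => [|k IH] f /= [cf df]; split=> //; try by move=> x /UU/cf.
by move=> i; have [dfi Cfi] := df i; split; [move=> x /UU/dfi|exact: IH].
Qed.

Lemma Ck_on_setU k U U' f : Ck_on k U f -> Ck_on k U' f -> Ck_on k (U `|` U') f.
Proof.
elim: k f => [|k IH] f /= [cf df] [cf' df'].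
  by split=> // x [/cf|/cf'].
split; first by move=> x [/cf|/cf'].
move=> i; have [dfi Cfi] := df i; have [dfi' Cfi'] := df' i.
by split; [move=> x [/dfi|/dfi']|exact: IH].
Qed.

Lemma Ck_on_sum k U (I : Type) (s : seq I) (F : I -> 'rV[R]_n -> R) :
  open U -> (forall i, Ck_on k U (F i)) ->
  Ck_on k U (fun x => \sum_(i <- s) F i x).
Proof.
move=> oU CF; elim: s => [|i s IH].
  by under eq_fun do rewrite big_nil; exact: Ck_on_cst.
by under eq_fun do rewrite big_cons; exact: Ck_onD.
Qed.

Lemma Ck_on_prod k U (I : Type) (s : seq I) (F : I -> 'rV[R]_n -> R) :
  open U -> (forall i, Ck_on k U (F i)) ->
  Ck_on k U (fun x => \prod_(i <- s) F i x).
Proof.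
move=> oU CF; elim: s => [|i s IH].
  by under eq_fun do rewrite big_nil; exact: Ck_on_cst.
by under eq_fun do rewrite big_cons; exact: Ck_onM.
Qed.

(** The outer function comes with the sequence of its derivatives, because the
    derivative of b_j o g is the product of b_{j+1} o g with that of g. *)
Lemma Ck_on_scalar_comp (b : nat -> R -> R) k U g j :
  (forall i (t : R), is_derive t 1 (b i) (b i.+1 t)) ->
  open U -> Ck_on k U g -> Ck_on k U (b j \o g).
Proof.
move=> db oU.
have cb i (t : R) : {for t, continuous (b i)}.
  by apply/differentiable_continuous/derivable1_diffP; case: (db i t).
elim: k g j => [|k IH] g j Cg; have [cg dg] := Cg; split=> //;
  try by move=> x Ux; apply: continuous_comp; [exact: cg|exact: cb].
move=> i; have [dgi Cgi] := dg i.
have D x : U x -> is_derive x (basis_vec i) (b j \o g)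
    (b j.+1 (g x) * 'D_(basis_vec i) g x).
  by move=> Ux; apply: is_derive_scalar_comp; exact/derivableP/dgi.
split=> [x /D[]//|].
apply: Ck_on_ext (Ck_onM oU (IH g j.+1 (Ck_onS Cg)) Cgi) => // x Ux.
by case: (D _ Ux).
Qed.

End smooth_calculus.

(** * The function exp(-1/t) and its derivatives *)

Section flat_function.
Context {R : realType}.
Implicit Types (P : {poly R}) (t : R).

(** The functions P(1/t) exp(-1/t), extended by 0, form a family that is closed
    under differentiation and contains the standard flat function exp(-1/t),
    which is the case P = 1. *)
Definition flat P t : R := if 0 < t then P.[t^-1] * expR (- t^-1) else 0.

Let exprn_expRN_le (k : nat) t : 0 < t ->
  t^-1 ^+ k * expR (- t^-1) <= k.+1`!%:R * t.
Proof.
move=> t0; have s0 : 0 < t^-1 by rewrite invr_gt0.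
rewrite expRN ler_pdivrMr ?expR_gt0//.
have := @expR_ge1Dxn R t^-1 k (ltW s0); rewrite -lerBrDl => H.
have {}H : t^-1 ^+ k.+1 / k.+1`!%:R <= expR t^-1.
  by rewrite (le_trans H)// gerBl.
move: H; rewrite ler_pdivrMr ?ltr0n ?fact_gt0// exprSr => H.
rewrite -(ler_pM2r s0) (le_trans H)//.
by rewrite [leRHS](_ : _ = expR t^-1 * (k.+1)`!%:R)//; field; rewrite gt_eqF.
Qed.

(* Applied to P X, this bound says that the difference quotient of flat P at 0
   tends to 0, since flat P t / t = flat (P X) t. *)
Let flat_le P : exists C : R, forall t, `|flat P t| <= C * `|t|.
Proof.
exists (\sum_(k < size P) `|P`_k| * k.+1`!%:R) => t.
rewrite /flat; case: ifPn => [t0|_]; last first.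
  rewrite normr0 mulr_ge0// sumr_ge0// => k _; exact: mulr_ge0.
rewrite horner_coef mulr_suml (gtr0_norm t0) mulr_suml.
rewrite (le_trans (ler_norm_sum _ _ _))// ler_sum// => k _.
rewrite -mulrA normrM -mulrA ler_wpM2l// ger0_norm ?exprn_expRN_le//.
by rewrite mulr_ge0 ?expR_ge0// exprn_ge0// invr_ge0 ltW.
Qed.

Lemma is_derive_flat P t : is_derive t 1 (flat P) (flat ('X^2 * (P - P^`())) t).
Proof.
have [t0|t0|<-] := ltgtP 0 t.
- have D1 : is_derive t 1 (fun s : R => s^-1) (- t ^- 2).
    have t_neq0 : (id : R -> R) t != 0 by rewrite gt_eqF.
    split; first exact: (derivableV t_neq0 (@derivable_id _ _ t 1)).
    by rewrite (deriveV t_neq0 (@derivable_id _ _ t 1)) derive_id [_ *: _]mulr1.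
  have D2 : is_derive t^-1 1 (fun s => P.[s] * expR (- s))
      ((P - P^`()).[t^-1] * - expR (- t^-1)).
    have dN : is_derive t^-1 1 (fun s : R => - s) (- 1) by exact: is_deriveN.
    have dE : is_derive t^-1 1 (fun s => expR (- s)) (expR (- t^-1) * - 1).
      exact: (@is_derive1_comp _ expR (fun s => - s)).
    have dP : is_derive t^-1 1 (horner P) P^`().[t^-1].
      by rewrite derivE derive1E; apply/derivableP/derivable_horner.
    apply: (is_derive_eq (is_deriveM dP dE)).
    by rewrite -![_ *: _]/(_ * _) hornerD hornerN; ring.
  have D := @is_derive1_comp _ _ (fun s : R => s^-1) t _ _ D2 D1.
  have N : \forall s \near t,
      ((fun s => P.[s] * expR (- s)) \o GRing.inv) s = flat P s.
    near=> s; rewrite /flat ifT//; near: s; exact: lt_nbhsr.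
  have := near_eq_is_derive N D; congr (is_derive _ _ _ _).
  by rewrite /flat t0 hornerM hornerXn exprVn; ring.
- have N : \forall s \near t, cst 0 s = flat P s.
    near=> s; rewrite /flat ifF//; apply/negbTE; rewrite -leNgt ltW//.
    near: s; exact: lt_nbhsl.
  rewrite {2}/flat ifF ?(lt_gtF t0)//.
  exact: near_eq_is_derive N (is_derive_cst _ _ _).
rewrite {2}/flat ltxx.
have [C HC] := flat_le (P * 'X).
have F0 : flat P 0 = 0 by rewrite /flat ltxx.
have L : h^-1 *: ((flat P \o shift 0) (h *: 1) - flat P 0) @[h --> 0^'] --> (0 : R).
  apply/cvgr0Pnorm_le => e e0.
  have C0 : 0 < `|C| + 1 by rewrite ltr_wpDl.
  near=> h; rewrite /= F0 subr0 addr0 [h%:A]mulr1.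
  have -> : h^-1 *: flat P h = flat (P * 'X) h.
    rewrite /flat; case: ifP => _; last by rewrite scaler0.
    by rewrite hornerMX -[_ *: _]/(_ * _); ring.
  rewrite (le_trans (HC h))// (@le_trans _ _ ((`|C| + 1) * `|h|))//.
    by rewrite ler_wpM2r// (le_trans (ler_norm _))// lerDl.
  rewrite mulrC -ler_pdivlMr//; apply: ltW.
  near: h; apply: dnbhs0_lt; exact: divr_gt0.
have D0 : derivable (flat P) 0 1 by apply/cvg_ex; exists 0.
by apply: DeriveDef => //; exact: cvg_lim L.
Unshelve. all: by end_near.
Qed.

Fixpoint flat_deriv (k : nat) : {poly R} :=
  if k is k'.+1 then 'X^2 * (flat_deriv k' - (flat_deriv k')^`()) else 1.

Lemma flat1_ge0 t : 0 <= flat 1 t.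
Proof. by rewrite /flat; case: ifP => // _; rewrite hornerC mul1r expR_ge0. Qed.

Lemma flat1_gt0 t : (0 < flat 1 t) = (0 < t).
Proof.
by rewrite /flat; case: ifP => _; rewrite ?ltxx// hornerC mul1r expR_gt0.
Qed.

End flat_function.

Lemma Ck_on_flat (R : realType) n k (U : set 'rV[R]_n) (g : 'rV[R]_n -> R) :
  open U -> Ck_on k U g -> Ck_on k U (flat 1 \o g).
Proof.
move=> oU Cg.
exact: (@Ck_on_scalar_comp _ _ (fun k => flat (flat_deriv k)) k U g 0%N
  (fun i t => is_derive_flat (flat_deriv i) t)).
Qed.

(** * Charts, continuity and bump functions on a manifold *)

Section manifold_basics.
Context {R : realType} {n : nat} {M : manifold R n}.
Implicit Types (c : chart_index M) (p : M) (v w : 'rV[R]_n) (f : C^oo(M)).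

Lemma chart_dom_open c : open (chart_dom (charts c)).
Proof. by case: (charts c). Qed.

Lemma chart_mapK c p : chart_dom (charts c) p ->
  chart_inv (charts c) (chart_map (charts c) p) = p.
Proof. by case: (charts c) => ? ? ? /= ? ? + ? ?; apply. Qed.

Lemma chart_map_continuous c p : chart_dom (charts c) p ->
  {for p, continuous (chart_map (charts c))}.
Proof. by case: (charts c) => ? ? ? /= ? ? ? + ?; apply. Qed.

Lemma chart_inv_continuous c v : chart_image (charts c) v ->
  {for v, continuous (chart_inv (charts c))}.
Proof.
by rewrite /chart_image; case: (charts c) => ? ? ? /= ? ? ? ? +; apply.
Qed.

Lemma chart_imageP c p : chart_dom (charts c) p ->
  chart_image (charts c) (chart_map (charts c) p).
Proof. by move=> cp; exists p. Qed.

Lemma chart_invK c v : chart_image (charts c) v ->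
  chart_map (charts c) (chart_inv (charts c) v) = v.
Proof. by move=> [p cp <-]; rewrite chart_mapK. Qed.

Lemma chart_inv_dom c v : chart_image (charts c) v ->
  chart_dom (charts c) (chart_inv (charts c) v).
Proof. by move=> [p cp <-]; rewrite chart_mapK. Qed.

Lemma chart_cover p : exists c, chart_dom (charts c) p.
Proof. by case: M p => ? ? ? ? ? H ? p; exact: H. Qed.

Lemma manifold_hausdorff : hausdorff_space M.
Proof. by case: M. Qed.

Lemma transition_smooth c c' j : smooth_on
  (chart_map (charts c) @` (chart_dom (charts c) `&` chart_dom (charts c')))
  (fun v => chart_map (charts c') (chart_inv (charts c) v) ord0 j).
Proof. by case: M c c' j => ? ? ? ? ? ? H c c' j; exact: H. Qed.

Lemma chart_map_open c (O : set M) : open O ->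
  open (chart_map (charts c) @` (chart_dom (charts c) `&` O)).
Proof.
move=> oO; rewrite openE => _ [p [cp Op] <-]; rewrite /interior.
have Ip := chart_imageP cp.
have N1 := open_nbhs_nbhs (conj (@open_chart_image _ _ M c) Ip).
have N2 : \forall v \near chart_map (charts c) p, O (chart_inv (charts c) v).
  apply: (chart_inv_continuous Ip); rewrite chart_mapK//.
  exact: open_nbhs_nbhs.
apply: filterS2 N1 N2 => v Iv Ov; exists (chart_inv (charts c) v).
  by split=> //; exact: chart_inv_dom.
exact: chart_invK.
Qed.

Lemma smooth_local c f : smooth_on (chart_image (charts c)) (local_repr c f).
Proof. by case: f => f /= /smooth_predP; apply. Qed.

Lemma smooth_continuous f : continuous f.
Proof.
move=> p; have [c cp] := chart_cover p.
have [cf _] := smooth_local c f 0%N.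
have E : \forall q \near p, (local_repr c f \o chart_map (charts c)) q = f q.
  near=> q; rewrite /local_repr/= chart_mapK//.
  by near: q; apply: open_nbhs_nbhs; split => //; exact: chart_dom_open.
have : {for p, continuous (local_repr c f \o chart_map (charts c))}.
  apply: continuous_comp; first exact: chart_map_continuous.
  exact/cf/chart_imageP.
rewrite /prop_for /continuous_at /= {2}/local_repr/= chart_mapK// => H.
exact: cvg_trans (near_eq_cvg E) H.
Unshelve. all: by end_near. Qed.

Definition chart_box c v r : set M :=
  chart_inv (charts c) @` [set w | `|w - v| <= r].

Lemma chart_box_compact c v r : 0 <= r ->
  [set w | `|w - v| <= r] `<=` chart_image (charts c) ->
  compact (chart_box c v r).
Proof.
move=> r0 sub; apply: continuous_compact.
  apply: continuous_in_subspaceT => w /set_mem /sub.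
  exact: chart_inv_continuous.
rewrite (_ : [set w | _] =
    [set w : 'rV[R]_n |
      forall j, `[v ord0 j - r, v ord0 j + r]%classic (w ord0 j)]).
  apply: (@rV_compact R n (fun j => `[v ord0 j - r, v ord0 j + r]%classic)) => j.
  exact: segment_compact.
apply/seteqP; split=> w /= wr.
  move=> j; have := le_trans (norm_coord_le _ j) wr.
  by rewrite !mxE ler_distl in_itv.
apply: norm_rV_le => // j.
by have := wr j; rewrite !mxE ler_distl in_itv.
Qed.

(* Positive exactly on the open ball of the maximum norm, which is a cube. *)
Let bump_coord v r w : R :=
  \prod_j (flat 1 (r + (w ord0 j - v ord0 j)) *
           flat 1 (r - (w ord0 j - v ord0 j))).

Let bump_coord_ge0 v r w : 0 <= bump_coord v r w.
Proof. by apply: prodr_ge0 => j _; rewrite mulr_ge0 ?flat1_ge0. Qed.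

Let flat_pair_gt0 (r t : R) : (0 < flat 1 (r + t) * flat 1 (r - t)) = (`|t| < r).
Proof.
have [tr|tr] := ltP `|t| r.
  move: tr; rewrite ltr_norml => /andP[? ?].
  by rewrite mulr_gt0// flat1_gt0; lra.
apply/negbTE; rewrite -leNgt; have [t0|t0] := leP 0 t.
  move: tr; rewrite ger0_norm// => tr.
  by rewrite (_ : flat 1 (r - t) = 0) ?mulr0// /flat ifF//; lra.
move: tr; rewrite ltr0_norm// => tr.
by rewrite (_ : flat 1 (r + t) = 0) ?mul0r// /flat ifF//; lra.
Qed.

Let bump_coord_gt0 v r w : 0 < r -> (0 < bump_coord v r w) = (`|w - v| < r).
Proof.
move=> r0; apply/idP/idP => [|wr]; last first.
  apply: prodr_gt0 => j _; rewrite flat_pair_gt0.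
  by have := le_lt_trans (norm_coord_le _ j) wr; rewrite !mxE.
apply: contraTT; rewrite -!leNgt => wr.
suff [j jr] : exists j, r <= `|w ord0 j - v ord0 j|.
  rewrite /bump_coord (bigD1 j)//= mulr_le0_ge0//.
    by rewrite leNgt flat_pair_gt0 -leNgt.
  by apply: prodr_ge0 => k _; rewrite mulr_ge0 ?flat1_ge0.
move: wr; rewrite leNgt norm_rV_lt// negb_forall => /existsP[j].
by rewrite !mxE -leNgt; exists j.
Qed.

(** Read in another chart c', the bump is a product of flat functions of the
    coordinates of the transition map on the part of dom c' that meets dom c,
    and it is 0 on the part of dom c' outside the compact box; these two open
    sets cover dom c'.  The second one is open because compact subsets of a
    Hausdorff space are closed. *)
Lemma bump_exists c v r : 0 < r ->
  [set w | `|w - v| <= r] `<=` chart_image (charts c) ->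
  exists phi : C^oo(M), [/\ forall p, 0 <= phi p,
    forall w, `|w - v| < r -> 0 < phi (chart_inv (charts c) w) &
    forall p, ~ chart_box c v r p -> phi p = 0].
Proof.
move=> r0 sub.
pose phi p := if `[< chart_dom (charts c) p >]
  then bump_coord v r (chart_map (charts c) p) else 0.
have phi0 p : ~ chart_box c v r p -> phi p = 0.
  move=> Kp; rewrite /phi; case: asboolP => // cp.
  apply/eqP; rewrite eq_le bump_coord_ge0 andbT leNgt bump_coord_gt0//.
  apply/negP => /ltW pr; apply: Kp; exists (chart_map (charts c) p) => //.
  exact: chart_mapK.
have Kc := chart_box_compact (ltW r0) sub.
have Kcl : closed (chart_box c v r).
  by apply: compact_closed => //; exact: manifold_hausdorff.
have sphi : phi \in @smooth_pred R n M.
  apply/smooth_predP => c' k.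
  have := Ck_on_setU (k := k) (f := phi \o chart_inv (charts c'))
    (U := chart_map (charts c') @`
      (chart_dom (charts c') `&` chart_dom (charts c)))
    (U' := chart_map (charts c') @`
      (chart_dom (charts c') `&` ~` chart_box c v r)).
  move=> H; apply: Ck_on_sub; last apply: H.
  - move=> _ [p c'p <-]; have [cp|ncp] := pselect (chart_dom (charts c) p).
      by left; exists p.
    right; exists p => //; split => // -[w /sub Iw pE]; apply: ncp.
    by rewrite -pE; exact: chart_inv_dom.
  - have oU := @chart_map_open c' _ (chart_dom_open c).
    have Ct j := @transition_smooth c' c j k.
    pose tau j w := chart_map (charts c) (chart_inv (charts c') w) ord0 j.
    have C1 j : Ck_on k (chart_map (charts c') @`
        (chart_dom (charts c') `&` chart_dom (charts c)))
      (fun w => tau j w - v ord0 j).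
      exact: (Ck_onD oU (Ct j) (Ck_on_cst _ (- v ord0 j) oU)).
    apply: (@Ck_on_ext _ _ k _ (fun w =>
      \prod_j (flat 1 (r + (tau j w - v ord0 j)) *
               flat 1 (r - (tau j w - v ord0 j))))) => //.
      move=> _ [p [c'p cp] <-]; rewrite /phi /tau/= chart_mapK//.
      by case: asboolP.
    apply: Ck_on_prod => // j; apply: Ck_onM => //.
      apply: (Ck_on_flat (g := fun w => r + (tau j w - v ord0 j))) => //.
      exact: (Ck_onD oU (Ck_on_cst _ r oU) (C1 j)).
    apply: (Ck_on_flat (g := fun w => r - (tau j w - v ord0 j))) => //.
    have := Ck_onD oU (Ck_on_cst _ r oU)
      (Ck_onM oU (Ck_on_cst _ (-1) oU) (C1 j)).
    by under eq_fun do rewrite mulN1r.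
  have oU := @chart_map_open c' _ (closed_openC Kcl).
  apply: (@Ck_on_ext _ _ k _ (fun=> 0)) => //; last exact: Ck_on_cst.
  by move=> _ [p [c'p Kp] <-]; rewrite /= chart_mapK// phi0.
exists (SmoothFun sphi); split => //= [p|w wr].
  by rewrite /phi; case: ifP.
have Iw := sub _ (ltW wr).
rewrite /phi; case: asboolP => [_|]; last by case; exact: chart_inv_dom.
by rewrite chart_invK// bump_coord_gt0.
Qed.

End manifold_basics.

(** * Double commutators of a second-order operator with functions *)

Section second_order_operators.
Context {R : realType} {n : nat} {M : manifold R n}.
Implicit Types (c : chart_index M) (p : M) (f g u phi : C^oo(M)).
Implicit Types (D : C^oo(M) -> C^oo(M)) (a : M -> 'M[R]_n).

Let image_nbhs c p : chart_dom (charts c) p ->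
  \forall v \near chart_map (charts c) p, chart_image (charts c) v.
Proof.
move=> cp; apply: open_nbhs_nbhs; split; first exact: open_chart_image.
exact: chart_imageP.
Qed.

Let derivable_local c f i v : chart_image (charts c) v ->
  derivable (local_repr c f) v (basis_vec i).
Proof.
by move=> Iv; have [_ /(_ i)[d _]] := smooth_local c f 1%N; exact: d.
Qed.

Let derivable_local2 c f i j v : chart_image (charts c) v ->
  derivable (fun w => 'D_(basis_vec j) (local_repr c f) w) v (basis_vec i).
Proof.
move=> Iv; have [_ /(_ j)[_ [_ /(_ i)[d _]]]] := smooth_local c f 2%N; exact: d.
Qed.

Let derive_localM c f g i v : chart_image (charts c) v ->
  'D_(basis_vec i) (local_repr c (f * g)) v =
  local_repr c f v * 'D_(basis_vec i) (local_repr c g) v +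
  local_repr c g v * 'D_(basis_vec i) (local_repr c f) v.
Proof.
move=> Iv.
have -> : local_repr c (f * g) = local_repr c f * local_repr c g by [].
by rewrite deriveM; [|exact: derivable_local..].
Qed.

Lemma partialM c i f g p : chart_dom (charts c) p ->
  partial c i (f * g) p = f p * partial c i g p + g p * partial c i f p.
Proof.
move=> cp; rewrite /partial derive_localM; last exact: chart_imageP.
by rewrite /local_repr/= chart_mapK.
Qed.

Lemma partial2M c i j f g p : chart_dom (charts c) p ->
  partial2 c i j (f * g) p =
  f p * partial2 c i j g p + g p * partial2 c i j f p +
  (partial c i f p * partial c j g p + partial c i g p * partial c j f p).
Proof.
move=> cp; rewrite /partial2.
have Ip := chart_imageP cp.
have E : \forall v \near chart_map (charts c) p,
    'D_(basis_vec j) (local_repr c (f * g)) v =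
    (local_repr c f \* (fun w => 'D_(basis_vec j) (local_repr c g) w) +
     local_repr c g \* (fun w => 'D_(basis_vec j) (local_repr c f) w)) v.
  by apply: filterS (image_nbhs cp) => v Iv; exact: derive_localM.
rewrite (near_eq_derive _ E) deriveD; last 2 first.
- by apply: derivableM; [exact: derivable_local|exact: derivable_local2].
- by apply: derivableM; [exact: derivable_local|exact: derivable_local2].
rewrite (@deriveM _ _ (local_repr c f)
  (fun w => 'D_(basis_vec j) (local_repr c g) w) _ _
  (@derivable_local c f i _ Ip) (@derivable_local2 c g i j _ Ip)).
rewrite (@deriveM _ _ (local_repr c g)
  (fun w => 'D_(basis_vec j) (local_repr c f) w) _ _
  (@derivable_local c g i _ Ip) (@derivable_local2 c f i j _ Ip)).
rewrite -![_ *: _]/(_ * _) /partial.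
have lE h : local_repr c h (chart_map (charts c) p) = h p.
  by rewrite /local_repr/= chart_mapK.
by rewrite !lE addrACA [X in _ + (X + _)]mulrC [X in _ + (_ + X)]mulrC.
Qed.

(** In the chart c, the squared-gradient form of the operator whose second-order
    part has the coefficients a; on functions it is the scalar product of the
    two gradients for the metric a^-1. *)
Definition carre_du_champ a c (f u : M -> R) p : R :=
  \sum_i \sum_j a p i j * (partial c i f p * partial c j u p).

Let carreM a c f u phi p : chart_dom (charts c) p ->
  carre_du_champ a c f (u * phi) p =
  u p * carre_du_champ a c f phi p + phi p * carre_du_champ a c f u p.
Proof.
move=> cp; rewrite /carre_du_champ !mulr_sumr -big_split/=; apply: eq_bigr => i _.
rewrite !mulr_sumr -big_split/=; apply: eq_bigr => j _.
by rewrite partialM//; ring.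
Qed.

(** The left-hand side is the value at p of [[D, f], u] phi.  The Leibniz rule
    gives D (f g) = f D g + g D f - e f g + Gamma(f, g), so that [D, f] is
    Gamma(f, .) up to a multiplication; Gamma(f, .) is a derivation, hence its
    commutator with u is multiplication by Gamma(f, u). *)
Lemma second_order_double_commutator D c a f u phi p :
  second_order_part D c a -> chart_dom (charts c) p ->
  D (f * (u * phi)) p - f p * D (u * phi) p
    - u p * (D (f * phi) p - f p * D phi p)
  = carre_du_champ a c f u p * phi p.
Proof.
move=> [sym _ [b [e [_ _ DE]]]] cp.
have carreC g h : \sum_i \sum_j a p i j * (partial c i g p * partial c j h p) =
   \sum_i \sum_j a p i j * (partial c i h p * partial c j g p).
  rewrite exchange_big; apply: eq_bigr => i _; apply: eq_bigr => j _.
  by rewrite -{1}(sym p cp) mxE [partial c j g p * _]mulrC.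
have sum2D (A B : 'I_n -> 'I_n -> R) :
    \sum_i \sum_j (A i j + B i j) = \sum_i \sum_j A i j + \sum_i \sum_j B i j.
  by rewrite -big_split/=; apply: eq_bigr => i _; rewrite -big_split.
have sum2Z (k : R) (A : 'I_n -> 'I_n -> R) :
    \sum_i \sum_j (k * A i j) = k * (\sum_i \sum_j A i j).
  by rewrite mulr_sumr; apply: eq_bigr => i _; rewrite mulr_sumr.
(* Only the product rules of the second- and first-order terms matter, so these
   terms are abstracted into S2 and S1. *)
have [S2 [S1 [{}DE S2M S1M]]] : exists S2 S1 : C^oo(M) -> R,
  [/\ forall h, D h p = 2^-1 * S2 h + S1 h + e p * h p,
      forall g h, S2 (g * h) = g p * S2 h + h p * S2 g +
        (carre_du_champ a c g h p + carre_du_champ a c g h p) &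
      forall g h, S1 (g * h) = g p * S1 h + h p * S1 g].
  exists (fun h => \sum_i \sum_j a p i j * partial2 c i j h p).
  exists (fun h => \sum_i b p ord0 i * partial c i h p).
  split=> [h|g h|g h]; first exact: DE.
    rewrite {2}/carre_du_champ (carreC g h) /carre_du_champ.
    rewrite -!sum2Z -!sum2D; apply: eq_bigr => i _; apply: eq_bigr => j _.
    rewrite partial2M//.
    move: (g p) (h p) (a p i j) => ? ? ?.
    move: (partial2 c i j h p) (partial2 c i j g p) => ? ?.
    move: (partial c i g p) (partial c j h p) => ? ?.
    move: (partial c i h p) (partial c j g p) => ? ?.
    ring.
  rewrite !mulr_sumr -big_split/=; apply: eq_bigr => i _.
  rewrite partialM//; move: (partial c i h p) (partial c i g p) => ? ?; ring.
have DM g h : D (g * h) p = g p * D h p + h p * D g p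
    - e p * g p * h p + carre_du_champ a c g h p.
  rewrite !DE S2M S1M -[(g * h) p]/(g p * h p).
  move: (S2 g) (S2 h) (S1 g) (S1 h) (carre_du_champ _ _ _ _ _) => ? ? ? ? ?.
  by field.
rewrite !DM carreM//.
rewrite -[(u * phi) p]/(u p * phi p).
move: (D (u * phi) p) (D f p) (D phi p) => ? ? ?.
move: (carre_du_champ _ _ _ _ _) (carre_du_champ _ _ _ _ _) => ? ?; ring.
Qed.

(** Differential operators do not increase supports. *)
Lemma second_order_local D phi p : second_order_nondegenerate D ->
  (\forall q \near p, phi q = 0) -> D phi p = 0.
Proof.
move=> /= nd phi0; have [c cp] := chart_cover p.
have [a [_ _ [b [e [_ _ DE]]]] _] := nd c.
have Ip := chart_imageP cp.
have near_inv (Q : set M) : (\forall q \near p, Q q) ->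
    \forall v \near chart_map (charts c) p, Q (chart_inv (charts c) v).
  move=> nP; have := chart_inv_continuous Ip.
  rewrite /prop_for/continuous_at chart_mapK//.
  exact.
have l0 : \forall v \near chart_map (charts c) p, local_repr c phi v = cst 0 v.
  exact: near_inv phi0.
have d0 i : \forall v \near chart_map (charts c) p,
   'D_(basis_vec i) (local_repr c phi) v = cst 0 v.
  have := near_join l0; apply: filterS => v lv.
  by rewrite (near_eq_derive _ lv) derive_cst.
rewrite DE// (nbhs_singleton phi0) mulr0 addr0 !big1 ?mulr0 ?addr0//.
  move=> i _; rewrite [partial _ _ _ _](nbhs_singleton (d0 i)) mulr0//.
move=> i _; rewrite big1// => j _; rewrite /partial2.
by rewrite (near_eq_derive _ (d0 j)) derive_cst mulr0.
Qed.

End second_order_operators.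

(** * Determinants of positive matrices and iterated integrals *)

(** Along the segment from the identity to A the matrices stay positive definite,
    so the determinant, a polynomial in the parameter, has no root on [0, 1]; it
    equals 1 at 0. *)
Lemma posdef_det_gt0 (R : realType) (n : nat) (A : 'M[R]_n) :
  (forall v : 'rV[R]_n, v != 0 -> 0 < (v *m A *m v^T) ord0 ord0) -> 0 < \det A.
Proof.
move=> posA.
pose p : {poly R} := \det ((1 - 'X)%:M + 'X *: map_mx polyC A).
have pE t : p.[t] = \det ((1 - t)%:M + t *: A).
  rewrite /p -/(horner_eval t _) -det_map_mx; congr (\det _).
  apply/matrixP => i j; rewrite !mxE /horner_eval /=.
  by rewrite [LHS]/horner_eval !(hornerE, hornerMn).
have p_neq0 t : 0 <= t <= 1 -> p.[t] != 0.
  move=> /andP[t0 t1]; rewrite pE; apply/det0P => -[v v0 vA].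
  have vv : 0 < (v *m v^T) ord0 ord0.
    rewrite mxE; have [j vj] : exists j, v ord0 j != 0.
      apply/existsP; apply: contraNT v0; rewrite negb_exists => /forallP v0.
      by apply/eqP/rowP => j; rewrite mxE; apply/eqP; have := v0 j; rewrite negbK.
    rewrite (bigD1 j)//= mxE -expr2 ltr_wpDr//; last by rewrite exprn_even_gt0.
    by apply: sumr_ge0 => k _; rewrite mxE -expr2 sqr_ge0.
  have : (v *m ((1 - t)%:M + t *: A) *m v^T) ord0 ord0 = 0.
    by rewrite vA mul0mx mxE.
  rewrite mulmxDr mulmxDl mul_mx_scalar -scalemxAl -scalemxAr -scalemxAl.
  rewrite mxE [X in X + _]mxE [X in _ + X]mxE => /eqP.
  apply/negP; rewrite gt_eqF//.
  have [t1'|t1'] := eqVneq t 1.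
    by rewrite t1' subrr mul0r add0r mul1r posA.
  rewrite ltr_pwDl//; first by rewrite mulr_gt0// subr_gt0 lt_neqAle t1'.
  by rewrite mulr_ge0// ltW// posA.
have p0 : p.[0] = 1 by rewrite pE subr0 scale0r addr0 det1.
have p1 : p.[1] = \det A by rewrite pE subrr scale1r raddf0 add0r.
rewrite -p1 ltNge; apply/negP => p1le.
have [] := @poly_ivt R (- p) 0 1 ler01.
  by rewrite !hornerN p0 oppr_le0 ler01 oppr_ge0.
move=> t t01; rewrite rootN => /rootP pt.
by have := p_neq0 t t01; rewrite pt eqxx.
Qed.

Section iterated_integral.
Context {R : realType}.
Local Open Scope ereal_scope.

(** The integral of a nonnegative function is a supremum over the simple
    functions below it, so monotonicity needs no measurability.  This matters
    for the iterated integral, whose inner integrals are not known to be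
    measurable functions of the outer variable. *)
Lemma ge0_le_integral_nonmeasurable d (T : measurableType d)
    (mu : {measure set T -> \bar R}) (f1 f2 : T -> \bar R) :
  (forall x, 0 <= f1 x) -> (forall x, f1 x <= f2 x) ->
  \int[mu]_x f1 x <= \int[mu]_x f2 x.
Proof.
move=> f10 f12.
rewrite !ge0_integralTE//; last by move=> x; exact: le_trans (f12 x).
apply: ereal_sup_le => _ [h /= hf <-]; exists h => //= x.
exact: le_trans (hf x) (f12 x).
Qed.

Lemma lebesgue_int_ge0 n (f : 'rV[R]_n -> \bar R) :
  (forall v, 0 <= f v) -> 0 <= lebesgue_int f.
Proof.
elim: n f => [|n IH] f f0 /=; first exact: f0.
by apply: integral_ge0 => t _; exact: IH.
Qed.

Lemma le_lebesgue_int n (f1 f2 : 'rV[R]_n -> \bar R) :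
  (forall v, 0 <= f1 v) -> (forall v, f1 v <= f2 v) ->
  lebesgue_int f1 <= lebesgue_int f2.
Proof.
elim: n f1 f2 => [|n IH] f1 f2 f0 f12 /=; first exact: f12.
apply: ge0_le_integral_nonmeasurable => t; first exact: lebesgue_int_ge0.
exact: IH.
Qed.

Lemma lebesgue_int_ball n (w : 'rV[R]_n) (r k : R) : (0 < r)%R -> (0 <= k)%R ->
  lebesgue_int (fun v => (k * (`|v - w| < r)%R%:R)%:E) = (k * (r *+ 2) ^+ n)%:E.
Proof.
move=> r0; elim: n w k => [|n IH] w k k0 /=.
  rewrite norm_rV_lt//.
  have -> // : [forall j : 'I_0, `|(0 - w)%R ord0 j| < r]%R.
  by apply/forallP => -[].
pose w0 : R := w ord0 ord0; pose w' : 'rV[R]_n := \row_j w ord0 (lift ord0 j).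
have row0 t (v : 'rV[R]_n) :
    row_mx (t%:M : 'rV[R]_1) v ord0 (ord0 : 'I_n.+1) = t.
  rewrite (_ : (ord0 : 'I_n.+1) = lshift n (ord0 : 'I_1)); last exact: val_inj.
  by rewrite row_mxEl mxE eqxx mulr1n.
have rowS t (v : 'rV[R]_n) j :
    row_mx (t%:M : 'rV[R]_1) v ord0 (lift (ord0 : 'I_n.+1) j) = v ord0 j.
  rewrite (_ : lift ord0 j = rshift 1 j); last exact: val_inj.
  by rewrite row_mxEr.
have ballE t (v : 'rV[R]_n) : (`|row_mx (t%:M : 'rV[R]_1) v - w| < r)%R =
    (`|t - w0| < r)%R && (`|v - w'| < r)%R.
  rewrite !norm_rV_lt//; apply/forallP/andP => [H|[H0 /forallP H] j].
    split; last apply/forallP => j.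
      by have := H ord0; rewrite mxE row0 mxE.
    by have := H (lift ord0 j); rewrite mxE rowS !mxE.
  case: (unliftP ord0 j) => [i|] ->; rewrite mxE.
    by have := H i; rewrite rowS !mxE.
  by rewrite row0 mxE.
pose I0 : set R := [set` `]w0 - r, w0 + r[%R].
have E t : lebesgue_int (fun v : 'rV[R]_n =>
    (k * (`|row_mx (t%:M : 'rV[R]_1) v - w| < r)%R%:R)%:E) =
    ((k * (r *+ 2) ^+ n)%R * \1_I0 t)%:E.
  under eq_fun do rewrite ballE -mulnb natrM mulrA.
  rewrite IH; last by rewrite mulr_ge0.
  by rewrite mulrAC indicE /I0 mem_setE in_itv/= ltr_distl.
transitivity (\int[@lebesgue_measure R]_t ((k * (r *+ 2) ^+ n)%R * \1_I0 t)%:E).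
  by apply: eq_integral => t _; exact: E.
have mI : measurable I0 by exact: measurable_itv.
have := @integralZl_indic _ _ _ (@lebesgue_measure R) setT measurableT (fun=> I0)
  (k * (r *+ 2) ^+ n)%R.
rewrite /= => -> //; last first.
  by move=> /lt_geF; rewrite mulr_ge0// exprn_ge0// mulrn_wge0// ltW.
have lI : lebesgue_measure I0 = (r *+ 2)%:E.
  rewrite /I0 lebesgue_measure_itv/= lte_fin ltrBlDr -addrA ltrDl addr_gt0//.
  by rewrite -EFinB; congr (_%:E); ring.
rewrite integral_indic// setIT -[X in _ * X](esym lI) -EFinM.
by rewrite exprSr mulrA.
Qed.

End iterated_integral.

(** * Riemannian volume and test functions *)

Section riemannian_volume.
Context {R : realType} {n : nat} {M : manifold R n}.
Context (g : riemannian_metric M) (omega : {measure set (borel M) -> \bar R}).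
Context (omegaP : is_riemannian_measure g omega).
Implicit Types (c : chart_index M) (p : M) (v w : 'rV[R]_n).

Definition chart_ball c v (r : R) : set M :=
  chart_inv (charts c) @` [set w | `|w - v| < r].

Lemma metric_posdef c p : chart_dom (charts c) p ->
  forall v, v != 0 -> 0 < (v *m g c p *m v^T) ord0 ord0.
Proof. by move=> cp v; case: (g) => G /= _ _ + _; exact. Qed.

Let volume_density c v : R := Num.sqrt (\det (g c (chart_inv (charts c) v))).

Let volume_density_continuous c v : chart_image (charts c) v ->
  {for v, continuous (volume_density c)}.
Proof.
move=> Iv.
have smooth_g i j : smooth_on (chart_image (charts c))
    (fun w => g c (chart_inv (charts c) w) i j).
  by case: (g) => G H *; exact: (H c i j).
have oI := @open_chart_image _ _ M c.
have det_g : Ck_on 0 (chart_image (charts c))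
    (fun w => \det (g c (chart_inv (charts c) w))).
  apply: Ck_on_sum => // s; apply: Ck_onM => //; first exact: Ck_on_cst.
  by apply: Ck_on_prod => // i; exact: smooth_g.
apply: continuous_comp; first by case: det_g => + _; exact.
exact: sqrt_continuous.
Qed.

Let volume_density_gt0 c v : chart_image (charts c) v -> 0 < volume_density c v.
Proof.
move=> Iv; rewrite sqrtr_gt0; apply: posdef_det_gt0.
exact/metric_posdef/chart_inv_dom.
Qed.

Lemma chart_ball_open c v r :
  [set w | `|w - v| < r] `<=` chart_image (charts c) ->
  open (chart_ball c v r).
Proof.
move=> sub.
rewrite (_ : chart_ball c v r =
  chart_dom (charts c) `&` [set p | `|chart_map (charts c) p - v| < r]); last first.
  apply/seteqP; split=> [_ [w wr <-]|p [cp pr]] /=.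
    have Iw := sub _ wr; split; first exact: chart_inv_dom.
    by rewrite chart_invK.
  by exists (chart_map (charts c) p) => //; exact: chart_mapK.
rewrite openE => p [cp /= pr]; rewrite /interior.
have N1 : \forall q \near p, chart_dom (charts c) q.
  by apply: open_nbhs_nbhs; split => //; exact: chart_dom_open.
have N2 : \forall q \near p, `|chart_map (charts c) q - v| < r.
  have o : open [set w : 'rV[R]_n | `|w - v| < r].
    rewrite (_ : [set w | _] = ball v r); first exact: ball_open.
    by apply/seteqP; split => w; rewrite -ball_normE/= distrC.
  exact: (chart_map_continuous cp (open_nbhs_nbhs (conj o pr))).
by apply: filterS2 N1 N2 => q; split.
Qed.

(** Near v the Riemannian density lies between half and twice its value at v, so
    the volume of a small ball is comparable with its Lebesgue measure. *)
Lemma chart_ball_volume c v : chart_image (charts c) v ->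
  exists2 r0 : R, 0 < r0 & forall r, 0 < r < r0 ->
    [set w | `|w - v| <= r] `<=` chart_image (charts c) /\
    (0 < omega (chart_ball c v r) < +oo)%E.
Proof.
move=> Iv; have s0 := volume_density_gt0 Iv; set s := volume_density c v in s0.
have : \forall w \near v, chart_image (charts c) w /\
    `|s - volume_density c w| < s / 2.
  apply: filterI.
    by apply: open_nbhs_nbhs; split => //; exact: open_chart_image.
  have /cvgrPdist_lt := volume_density_continuous Iv; apply.
  by rewrite divr_gt0.
move=> /nbhs_ballP[r0 /= r00 Hr0]; exists r0 => // r /andP[r_gt0 rr0].
have {}Hr0 w : `|w - v| <= r -> chart_image (charts c) w /\
    `|s - volume_density c w| < s / 2.
  by move=> wr; apply: Hr0; rewrite -ball_normE/= distrC (le_lt_trans wr).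
split=> [w /Hr0[]//|].
have ballI : [set w | `|w - v| < r] `<=` chart_image (charts c).
  by move=> w /= /ltW /Hr0[].
rewrite (omegaP (c := c)); last 2 first.
- by apply: sub_sigma_algebra; exact: chart_ball_open.
- by move=> _ [w /ballI Iw <-]; exact: chart_inv_dom.
have -> : chart_map (charts c) @` chart_ball c v r = [set w | `|w - v| < r].
  apply/seteqP; split=> [_ [_ [w wr <-] <-]|w wr] /=.
    by rewrite chart_invK//; exact: ballI.
  exists (chart_inv (charts c) w); first by exists w.
  by rewrite chart_invK//; exact: ballI.
pose f (k : R) w : \bar R := (k * (`|w - v| < r)%R%:R)%:E.
have fE k : 0 < k -> lebesgue_int (f k) = (k * (r *+ 2) ^+ n)%:E.
  by move=> k0; apply: lebesgue_int_ball => //; exact: ltW.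
have indE w : \1_[set w | `|w - v| < r] w = (`|w - v| < r)%R%:R :> R.
  by rewrite indicE; congr (nat_of_bool _)%:R; apply/idP/idP => [/set_mem|/mem_set].
apply/andP; split.
  apply: (@lt_le_trans _ _ (lebesgue_int (f (s / 2)))).
    rewrite fE ?divr_gt0// lte_fin mulr_gt0 ?divr_gt0// exprn_gt0//.
    by rewrite mulrn_wgt0.
  apply: le_lebesgue_int => w.
    by rewrite lee_fin mulr_ge0// ltW// divr_gt0.
  rewrite lee_fin indE; case: ltP => wr; last by rewrite mulr0 mul0r.
  rewrite mulr1 mul1r; have [_] := Hr0 _ (ltW wr).
  by rewrite -/(volume_density c w) ltr_distl; lra.
apply: (@le_lt_trans _ _ (lebesgue_int (f (s *+ 2)))).
  2: by rewrite fE ?ltry// mulrn_wgt0.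
apply: le_lebesgue_int => w; first by rewrite lee_fin mulr_ge0// sqrtr_ge0.
rewrite lee_fin indE; case: ltP => wr; last by rewrite mulr0 mul0r.
rewrite mulr1 mul1r; have [_] := Hr0 _ (ltW wr).
by rewrite -/(volume_density c w) ltr_distl; lra.
Qed.

(** The support is required to lie in an open set of finite volume, which makes
    test functions integrable without knowing that all compact sets have finite
    volume. *)
Definition test_function (phi : M -> R) : Prop :=
  exists K A : set M, [/\ compact K, open A, K `<=` A, (omega A < +oo)%E &
    forall p, ~ K p -> phi p = 0].

Lemma test_functionM (phi u : C^oo(M)) : test_function phi ->
  test_function (phi * u : C^oo(M)).
Proof.
move=> [K [A [cK oA KA Aoo phi0]]]; exists K, A; split=> // p /phi0 /= phip.
by rewrite -[LHS]/(phi p * u p) phip mul0r.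
Qed.

Let outside_compact (K : set M) p : compact K -> ~ K p ->
  \forall q \near p, ~ K q.
Proof.
move=> cK Kp; have oK : open (~` K).
  by apply: closed_openC; apply: compact_closed => //; exact: manifold_hausdorff.
exact: open_nbhs_nbhs.
Qed.

Lemma test_function_second_order D (phi : C^oo(M)) :
  second_order_nondegenerate D -> test_function phi -> test_function (D phi).
Proof.
move=> nd [K [A [cK oA KA Aoo phi0]]]; exists K, A; split=> // p Kp.
apply: second_order_local nd _.
by apply: filterS (outside_compact cK Kp) => q /phi0.
Qed.

Lemma test_function_compactly_supported phi :
  test_function phi -> compactly_supported phi.
Proof.
move=> [K [A [cK oA KA Aoo phi0]]].
apply: (subclosed_compact _ cK); first exact: closed_closure.
have clK : closed K by apply: compact_closed => //; exact: manifold_hausdorff.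
rewrite ((closure_id K).1 clK); apply: closureS => p /= /eqP phip.
by apply: contrapT => /phi0.
Qed.

Lemma continuous_borel_measurable (q : M -> R) : continuous q ->
  measurable_fun setT (q : borel M -> R).
Proof.
move=> cq; apply: (measurability _ (measurable_realfun.RGenOInfty.measurableE R)).
move=> _ [_ [a ->] <-]; rewrite setTI; apply: sub_sigma_algebra.
by apply: open_comp => // *; exact: cq.
Qed.

Lemma test_function_integrable (q : C^oo(M)) : test_function q ->
  omega.-integrable setT (EFin \o (q : borel M -> R)).
Proof.
move=> [K [A [cK oA KA Aoo q0]]].
have cq := @smooth_continuous _ _ M q.
have mA : measurable (A : set (borel M)) by exact: sub_sigma_algebra.
have [B [_ HB]] : bounded_set (q @` K).
  apply: compact_bounded; apply: continuous_compact => //.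
  exact: continuous_subspaceT.
have -> : EFin \o (q : borel M -> R) = (EFin \o q) \_ A.
  apply/funext => p; rewrite patchE; case: ifPn => // /negP Ap /=.
  by rewrite q0// => Kp; apply: Ap; apply/mem_set/KA.
apply/(integrable_mkcond _ mA); apply: measurable_bounded_integrable => //.
  by apply: measurable_funS (continuous_borel_measurable cq).
exists (Num.max B 0); split; first exact: num_real.
move=> r; rewrite gt_max => /andP[Br r0] p _ /=.
have [Kp|/q0->] := pselect (K p); last by rewrite normr0 ltW.
by apply: HB => //; exists p.
Qed.

(** If w = w1 - w2 is not 0 at p0, take a bump phi around p0 on whose support w
    has constant sign.  Then |phi w| has integral 0, so phi w vanishes almost
    everywhere, although it does not vanish on a ball of positive volume. *)
Lemma test_function_Rintegral_eq (w1 w2 : C^oo(M)) :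
  (forall phi : C^oo(M), test_function phi ->
    \int[omega]_p (phi p * w1 p) = \int[omega]_p (phi p * w2 p)) -> w1 = w2.
Proof.
move=> H; apply/val_inj/funext => p0; apply: contrapT => w12.
pose w : C^oo(M) := w1 - w2.
have wE p : w p = w1 p - w2 p by [].
have w0 : w p0 != 0 by rewrite wE subr_eq0; apply/eqP.
have [c cp] := chart_cover p0; have Ip := chart_imageP cp.
set v := chart_map (charts c) p0 in Ip.
have [r0 r00 Hr0] := chart_ball_volume Ip.
have : \forall u \near v, 0 < w p0 * w (chart_inv (charts c) u).
  have cw : {for v, continuous (fun u => w p0 * w (chart_inv (charts c) u))}.
    apply: continuousM; first exact: cst_continuous.
    by have [+ _] := smooth_local c w 0%N; apply.
  apply: (cvgr_gt _ cw); rewrite /v chart_mapK// -expr2.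
  by rewrite exprn_even_gt0.
move=> /nbhs_ballP[d /= d0 Hd].
have [r [r_gt0 rd rr0]] : exists r, [/\ 0 < r, r < d & r < r0].
  exists (Num.min d r0 / 2); split.
  - by rewrite divr_gt0// lt_min d0.
  - by rewrite ltr_pdivrMr// gt_min; apply/orP; left; lra.
  - by rewrite ltr_pdivrMr// gt_min; apply/orP; right; lra.
(* The slightly larger ball of radius r' is the open set of finite volume around
   the closed box of radius r. *)
pose r' := (r + r0) / 2.
have [sub Vr] := Hr0 r (introT andP (conj r_gt0 rr0)).
have [sub' Vr'] : [set w | `|w - v| <= r'] `<=` chart_image (charts c) /\
    (0 < omega (chart_ball c v r') < +oo)%E.
  by apply: Hr0; rewrite /r'; lra.
have [phi [phi_ge0 phi_gt0 phi0]] := bump_exists r_gt0 sub.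
have tphi : test_function phi.
  exists (chart_box c v r), (chart_ball c v r'); split=> //.
  - by apply: chart_box_compact => //; exact: ltW.
  - by apply: chart_ball_open => u /= /ltW; exact: sub'.
  - by move=> _ [u ur <-]; exists u => //=; move: ur => /= ur; rewrite /r'; lra.
  - by case/andP: Vr'.
have tw (u : C^oo(M)) := test_function_integrable (test_functionM u tphi).
have int0 : \int[omega]_p (phi p * w p) = 0.
  under eq_Rintegral do rewrite wE mulrBr.
  by rewrite RintegralB//; [rewrite H// subrr|exact: tw..].
have {}int0 : (\int[omega]_p (phi p * w p)%:E = 0)%E.
  have := integrable_fin_num measurableT (tw w).
  by move=> /fineK <-; congr (_%:E).
have absE p : `|phi p * w p| = Num.sg (w p0) * (phi p * w p).
  have [[u ur <-]|/phi0->] := pselect (chart_box c v r p).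
    2: by rewrite !mul0r mulr0 normr0.
  rewrite normrM ger0_norm// mulrCA; congr (_ * _).
  have := Hd u; rewrite -ball_normE/= distrC => /(_ (le_lt_trans ur rd)).
  case: (ltgtP (w p0) 0) => [w_lt0|w_gt0|e].
  - rewrite nmulr_rgt0// => /ltr0_norm ->; rewrite ltr0_sg// mulN1r//.
  - rewrite pmulr_rgt0// => /gtr0_norm ->; rewrite gtr0_sg// mul1r//.
  - by move: w0; rewrite e eqxx.
have /integrableP[mw _] := tw w.
have /(ae_eq_integral_abs _ measurableT mw) ae0 :
    (\int[omega]_p `|(phi p * w p)%:E| = 0)%E.
  transitivity ((Num.sg (w p0))%:E * \int[omega]_p (phi p * w p)%:E)%E.
    rewrite -integralZl//; last exact: tw.
    by apply: eq_integral => p _ /=; rewrite -EFinM -absE.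
  by rewrite int0 mule0.
have : omega.-negligible (chart_ball c v r).
  apply: negligibleS ae0 => _ [u /= ur <-] /(_ I) /= [] /eqP.
  rewrite mulf_eq0 gt_eqF ?phi_gt0//= => /eqP wu.
  have := Hd u; rewrite -ball_normE/= distrC => /(_ (lt_trans ur rd)).
  by rewrite wu mulr0 ltxx.
have mB : measurable (chart_ball c v r : set (borel M)).
  by apply: sub_sigma_algebra; apply: chart_ball_open => u /= /ltW; exact: sub.
move=> /(negligibleP _ mB) V0.
by move: Vr; rewrite V0 ltxx.
Qed.

End riemannian_volume.

(** * Double commutators of the formal adjoint *)

Section formal_adjoint.
Context {R : realType} {n : nat} {M : manifold R n}.
Context (g : riemannian_metric M) (omega : {measure set (borel M) -> \bar R}).
Context (omegaP : is_riemannian_measure g omega).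
Context (L Lstar : C^oo(M) -> C^oo(M)).
Context (L_nondegenerate : second_order_nondegenerate L).
Context (LstarP : is_formal_adjoint omega L Lstar).
Implicit Types (f u phi psi : C^oo(M)).

Definition double_commutator (D : C^oo(M) -> C^oo(M)) f u :
  C^oo(M) -> C^oo(M) :=
  commutator (commutator D (mul_op f)) (mul_op u).

Lemma double_commutatorE (D : C^oo(M) -> C^oo(M)) f u psi p :
  double_commutator D f u psi p =
  D (f * (u * psi)) p - f p * D (u * psi) p
    - u p * (D (f * psi) p - f p * D psi p).
Proof. by []. Qed.

Lemma double_commutator_carre a c f u p : second_order_part L c a ->
  chart_dom (charts c) p ->
  double_commutator L f u 1 p = carre_du_champ a c f u p.
Proof.
move=> La cp; rewrite double_commutatorE.
rewrite (second_order_double_commutator f u 1 La cp).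
exact: mulr1.
Qed.

Let double_commutator_mul f u psi :
  double_commutator L f u psi = double_commutator L f u 1 * psi.
Proof.
apply/val_inj/funext => p; have [c cp] := chart_cover p.
rewrite -[LHS]/(double_commutator L f u psi p).
rewrite -[RHS]/(double_commutator L f u 1 p * psi p).
have [a La _] := L_nondegenerate c.
rewrite double_commutatorE (second_order_double_commutator f u psi La cp).
by rewrite -(double_commutator_carre f u La cp).
Qed.

Let test_functionB (q1 q2 : C^oo(M)) : test_function omega q1 ->
  test_function omega q2 -> test_function omega (q1 - q2 : C^oo(M)).
Proof.
move=> [K1 [A1 [cK1 oA1 KA1 Aoo1 q10]]] [K2 [A2 [cK2 oA2 KA2 Aoo2 q20]]].
exists (K1 `|` K2), (A1 `|` A2); split.
- exact: compactU.
- exact: openU.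
- exact: setUSS.
- apply: (@le_lt_trans _ _ (omega A1 + omega A2)%E).
    2: by rewrite lte_add_pinfty.
  by apply: measureU2; exact: sub_sigma_algebra.
- move=> p /not_orP[/q10 E1 /q20 E2].
  by rewrite -[LHS]/(q1 p - q2 p) E1 E2 subrr.
Qed.

Let RintegralB_test (q1 q2 : C^oo(M)) : test_function omega q1 ->
  test_function omega q2 ->
  \int[omega]_p ((q1 - q2 : C^oo(M)) p) =
  \int[omega]_p (q1 p) - \int[omega]_p (q2 p).
Proof.
by move=> t1 t2; apply: RintegralB => //; exact: test_function_integrable.
Qed.

(** Against a test function, each of the four terms of [[L^*, f], u] psi is
    moved to L; the result is the integral of ([[L, f], u] phi) psi, and
    [[L, f], u] is a multiplication. *)
Lemma adjoint_double_commutator f u psi :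
  double_commutator Lstar f u psi = double_commutator L f u 1 * psi.
Proof.
apply: (test_function_Rintegral_eq omegaP) => phi tphi.
have tL (q : C^oo(M)) : test_function omega q -> test_function omega (L q).
  exact: test_function_second_order.
have tM (q v : C^oo(M)) : test_function omega q ->
    test_function omega (q * v : C^oo(M)).
  exact: test_functionM.
have adj (q v : C^oo(M)) : test_function omega q ->
    \int[omega]_p ((q * Lstar v : C^oo(M)) p) =
    \int[omega]_p ((L q * v : C^oo(M)) p).
  by move=> tq; apply/esym/LstarP; exact: test_function_compactly_supported tq.
transitivity (\int[omega]_p (((phi * Lstar (f * (u * psi))
    - phi * f * Lstar (u * psi)) -
  (phi * u * Lstar (f * psi) - phi * u * f * Lstar psi) : C^oo(M)) p)).
  congr Rintegral; apply/funext => p.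
  rewrite double_commutatorE -[RHS]/((phi p * Lstar (f * (u * psi)) p
      - phi p * f p * Lstar (u * psi) p) -
    (phi p * u p * Lstar (f * psi) p - phi p * u p * f p * Lstar psi p)).
  move: (Lstar (f * (u * psi)) p) (Lstar (u * psi) p) => ? ?.
  by move: (Lstar (f * psi) p) (Lstar psi p) => ? ?; ring.
have tf := tM phi f tphi; have tu := tM phi u tphi.
have tuf := tM _ f tu.
rewrite (RintegralB_test (test_functionB (tM _ _ tphi) (tM _ _ tf))
  (test_functionB (tM _ _ tu) (tM _ _ tuf))).
rewrite (RintegralB_test (tM _ _ tphi) (tM _ _ tf)).
rewrite (RintegralB_test (tM _ _ tu) (tM _ _ tuf)).
rewrite (adj _ _ tphi) (adj _ _ tf) (adj _ _ tu) (adj _ _ tuf).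
rewrite -(RintegralB_test (tM _ _ (tL _ tphi)) (tM _ _ (tL _ tf))).
rewrite -(RintegralB_test (tM _ _ (tL _ tu)) (tM _ _ (tL _ tuf))).
rewrite -(RintegralB_test (test_functionB (tM _ _ (tL _ tphi)) (tM _ _ (tL _ tf)))
  (test_functionB (tM _ _ (tL _ tu)) (tM _ _ (tL _ tuf)))).
congr Rintegral; apply/funext => p.
transitivity (double_commutator L f u phi p * psi p); last first.
  rewrite double_commutator_mul.
  rewrite -[LHS]/(double_commutator L f u 1 p * phi p * psi p).
  rewrite -[RHS]/(phi p * (double_commutator L f u 1 p * psi p)).
  by rewrite mulrCA mulrA.
have -> : phi * u * f = f * (u * phi) by rewrite mulrC [phi * u]mulrC.
rewrite double_commutatorE [phi * f]mulrC [phi * u]mulrC.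
rewrite -[LHS]/((L phi p * (f p * (u p * psi p))
     - L (f * phi) p * (u p * psi p)) -
    (L (u * phi) p * (f p * psi p) - L (f * (u * phi)) p * psi p)).
move: (L (f * (u * phi)) p) (L (u * phi) p) => ? ?.
by move: (L (f * phi) p) (L phi p) => ? ?; ring.
Qed.

(** Multiplications commute, so subtracting one from L^* changes nothing. *)
Lemma double_commutator_potential (s : C^oo(M)) (k : R) f u :
  double_commutator (Lstar - k *: mul_op s) f u =
  mul_op (double_commutator L f u 1).
Proof.
apply/funext => psi; rewrite /mul_op -adjoint_double_commutator.
apply/val_inj/funext => p.
rewrite -[LHS]/(double_commutator (Lstar - k *: mul_op s) f u psi p).
rewrite -[RHS]/(double_commutator Lstar f u psi p) !double_commutatorE.
have E psi' : (Lstar - k *: mul_op s) psi' p =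
    Lstar psi' p - k * (s p * psi' p) by [].
rewrite !E.
rewrite -[(f * (u * psi)) p]/(f p * (u p * psi p)) -[(f * psi) p]/(f p * psi p).
rewrite -[(u * psi) p]/(u p * psi p).
move: (Lstar (f * (u * psi)) p) (Lstar (u * psi) p) => ? ?.
by move: (Lstar (f * psi) p) (Lstar psi p) => ? ?; ring.
Qed.

End formal_adjoint.

(** * Functions along a gradient flow line *)

Section gradient_curve.
Context {R : realType} {n : nat} {M : manifold R n}.
Context (g : riemannian_metric M).
Implicit Types (c : chart_index M) (f u : C^oo(M)) (gamma : R -> M).

Lemma differential_carre a c f u p : g c p = invmx (a p) ->
  carre_du_champ a c f u p =
  \sum_j gradient g f c p ord0 j * partial c j u p.
Proof.
move=> ga; rewrite /carre_du_champ /gradient ga invmxK exchange_big/=.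
apply: eq_bigr => j _; rewrite mxE mulr_suml; apply: eq_bigr => i _.
by rewrite mxE; ring.
Qed.

(** Gamma(f, f) is the squared length of the gradient of f. *)
Lemma carre_eq0_gradient a c f p : chart_dom (charts c) p ->
  (a p)^T = a p -> g c p = invmx (a p) ->
  carre_du_champ a c f f p = 0 -> gradient g f c p = 0.
Proof.
move=> cp sym ga Q0; apply: contrapT => /eqP grad0.
have := metric_posdef g cp grad0.
have gu : g c p \in unitmx.
  by rewrite unitmxE unitfE gt_eqF//; exact: posdef_det_gt0 (metric_posdef g cp).
have ag : a p *m g c p = 1%:M by rewrite ga mulmxV// -unitmx_inv -ga.
rewrite {1 2}/gradient ga invmxK -ga -(mulmxA (differential c f p)) ag mulmx1.
rewrite mxE; suff -> : \sum_j differential c f p ord0 j *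
    (differential c f p *m a p)^T j ord0 = carre_du_champ a c f f p.
  by rewrite Q0 ltxx.
rewrite (differential_carre _ _ ga) /gradient ga invmxK; apply: eq_bigr => j _.
by rewrite [X in _ * X]mxE [X in X * _]mxE mulrC.
Qed.

Let near_chart gamma c t : continuous gamma -> chart_dom (charts c) (gamma t) ->
  \forall s \near t, chart_dom (charts c) (gamma s).
Proof.
move=> cg cgt; apply: cg; apply: open_nbhs_nbhs.
by split => //; exact: chart_dom_open.
Qed.

Lemma is_derive_gradient_flow f u gamma c (t : R) :
  gradient_flow_line g f gamma ->
  chart_dom (charts c) (gamma t) ->
  is_derive t 1 (u \o gamma)
    (\sum_j gradient g f c (gamma t) ord0 j * partial c j u (gamma t)).
Proof.
move=> [cg flow] cgt.
have D := is_derive_curve (@open_chart_image _ _ M c) (smooth_local c u 1%N)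
  (chart_imageP cgt) (flow t c cgt).
apply: near_eq_is_derive D.
apply: filterS (near_chart cg cgt) => s cgs.
by rewrite /local_repr/= chart_mapK.
Qed.

(** The set of times at which gamma takes its initial value is closed, and open
    because the coordinates of gamma have zero derivative in every chart. *)
Lemma gradient_flow_constant f gamma : gradient_flow_line g f gamma ->
  (forall t c, chart_dom (charts c) (gamma t) -> gradient g f c (gamma t) = 0) ->
  forall t, gamma t = gamma 0.
Proof.
move=> [cg flow] grad0.
have : connected [set: R] by apply/connected_intervalP => x y _ _ z _.
move=> /(_ [set t | gamma t = gamma 0]) C.
suff E : [set t | gamma t = gamma 0] = setT.
  by move=> t; rewrite -[_ = _]/([set t | gamma t = gamma 0] t) E.
apply: C.
- by exists 0.
- exists [set t | gamma t = gamma 0]; last by rewrite setTI.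
  rewrite openE => t /= gt0; rewrite /interior.
  have [c cgt] := chart_cover (gamma t).
  have /nbhs_ballP[d /= d0 dom] := near_chart cg cgt.
  apply/nbhs_ballP; exists d => // s ts /=; rewrite -gt0.
  have dom' (r : R) : Num.min t s <= r <= Num.max t s ->
      chart_dom (charts c) (gamma r).
    move=> rts; apply: dom; move: ts rts; rewrite /ball/= !ltr_norml.
    by case: (leP t s) => st; lra.
  rewrite -(chart_mapK (dom' s _)); last by rewrite ge_min le_max !lexx !orbT.
  rewrite -(chart_mapK cgt); congr (chart_inv _ _); apply/rowP => j.
  pose k r := chart_map (charts c) (gamma r) ord0 j.
  have Dk r : Num.min t s <= r <= Num.max t s -> is_derive r 1 k 0.
    move=> /dom' cgr; have [d1 d2] := flow r c cgr.
    have dj := (derivable_mxP _ _ _).1 d1 ord0 j.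
    split=> //; move: d2; rewrite derive_mx// grad0// => /rowP/(_ j).
    by rewrite !mxE.
  have mM : Num.min t s <= Num.max t s by rewrite le_max !ge_min lexx.
  have Dk' r : r \in `]Num.min t s, Num.max t s[ -> is_derive r 1 k 0.
    by rewrite in_itv/= => /andP[/ltW r1 /ltW r2]; apply: Dk; rewrite r1.
  have [|r _] := MVT_segment mM Dk'.
    by apply: derivable_within_continuous => r; rewrite in_itv/= => /Dk[].
  by rewrite mul0r => /eqP; rewrite subr_eq0 /k; case: (leP t s) => _ /eqP ->.
- exists [set t | gamma t = gamma 0]; last by rewrite setTI.
  have cl : closed [set gamma 0].
    exact/accessible_closed_set1/hausdorff_accessible/manifold_hausdorff.
  exact: (continuous_closedP gamma).1 cg _ cl.
Qed.

End gradient_curve.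

(** * Infinite dimension of the estimation algebra *)

Lemma finite_dimensional_relation (R : realType) (V : lmodType R) (E : set V)
    (x : nat -> V) : finite_dimensional E -> (forall j, E (x j)) ->
  exists N (k : 'rV[R]_N), k != 0 /\ \sum_(j < N) k ord0 j *: x j = 0.
Proof.
move=> [N [b [_ span]]] Ex.
have /choice[K KE] : forall j, exists K : 'I_N -> R, x j = \sum_i K i *: b i.
  by move=> j; exact/span/Ex.
pose A : 'M[R]_(N.+1, N) := \matrix_(j, i) K j i.
have /rowV0Pn[k /sub_kermxP kA k0] : kermx A != 0.
  by rewrite kermx_eq0 -row_leq_rank -ltnNge ltnS rank_leq_col.
exists N.+1, k; split => //.
under eq_bigr do rewrite KE scaler_sumr.
rewrite exchange_big big1//= => i _.
under eq_bigr do rewrite scalerA.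
rewrite -scaler_suml; have /rowP/(_ i) := kA; rewrite !mxE => kAi.
rewrite [X in X *: _](_ : _ = 0) ?scale0r// -[RHS]kAi.
by apply: eq_bigr => j _; rewrite mxE.
Qed.

Theorem theorem2 (R : realType) (n l m : nat) (M : manifold R n)
    (V0 : vector_field M) (V : 'I_l -> vector_field M) (h : 'I_m -> C^oo(M))
    (d : measure_display) (Omega : measurableType d) (P : probability Omega R)
    (F : R -> set (set Omega))
    (W : 'I_l -> R -> Omega -> R) (B : 'I_m -> R -> Omega -> R)
    (X : R -> Omega -> M) (Y : 'I_m -> R -> Omega -> R)
    (g : riemannian_metric M) (omega : {measure set (borel M) -> \bar R})
    (Lstar : C^oo(M) -> C^oo(M))
    (i : 'I_m) (x y : M) (gamma : R -> M) :
  signal_observation_model P V0 V h F W B X Y ->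
  second_order_nondegenerate (generator V0 V) ->
  metric_attached_to (generator V0 V) g ->
  is_riemannian_measure g omega ->
  is_formal_adjoint omega (generator V0 V) Lstar ->
  critical_point (h i) x ->
  critical_point (h i) y ->
  x <> y ->
  gradient_flow_line g (h i) gamma ->
  gamma t @[t --> -oo] --> x ->
  gamma t @[t --> +oo] --> y ->
  ~ finite_dimensional (estimation_algebra Lstar h).
Proof.
move=> _ nd La omegaP LstarP critx crity xy flow gx gy fd.
set L := generator V0 V in nd La LstarP.
(* Evaluating the double commutator at the constant function 1 gives
   Gamma(h i, u) as a smooth function on M, with no choice of chart. *)
pose f (k : nat) : C^oo(M) := iter k (fun u => double_commutator L (h i) u 1) (h i).
have fS k : f k.+1 = double_commutator L (h i) (f k) 1 by [].
have Emul k : estimation_algebra Lstar h (mul_op (f k)).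
  elim: k => [|k IH]; first by apply: lie_gen; right; exists i.
  rewrite fS -(double_commutator_potential omegaP nd LstarP (\sum_j h j ^+ 2) 2^-1).
  apply: lie_bracket IH; apply: lie_bracket; first by apply: lie_gen; left.
  by apply: lie_gen; right; exists i.
have [N [k [k0 rel]]] := finite_dimensional_relation fd (fun j => Emul j.+1).
have fSE c j p : chart_dom (charts c) p ->
    f j.+1 p = \sum_e gradient g (h i) c p ord0 e * partial c e (f j) p.
  move=> cp; have [a Lca ga] := La c.
  rewrite fS (double_commutator_carre _ _ Lca cp).
  by apply: differential_carre; exact: ga.
pose phi j t := f j.+1 (gamma t).
have dphi j (t : R) : is_derive t 1 (phi j) (phi j.+1 t).
  have [c cgt] := chart_cover (gamma t).
  by rewrite /phi (fSE c)//; exact: is_derive_gradient_flow.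
have f_crit j p : critical_point (h i) p -> f j.+1 p = 0.
  move=> critp; have [c cp] := chart_cover p.
  rewrite (fSE c)// big1// => e _.
  by rewrite /gradient critp// mul0mx mxE mul0r.
have cvgphi (G : set_system R) p j : Filter G -> gamma t @[t --> G] --> p ->
    critical_point (h i) p -> phi j t @[t --> G] --> 0.
  move=> FG Gp critp; rewrite -(f_crit j p critp).
  exact: (@cvg_comp _ _ _ gamma (f j.+1 : M -> R) _ _ _ Gp
    (@smooth_continuous _ _ _ (f j.+1) p)).
have phi0 : forall t, phi 0%N t = 0.
  apply: (@linear_relation_vanish _ phi N k) => // [j|j|t].
  - exact: cvgphi gx critx.
  - exact: cvgphi gy crity.
  transitivity ((\sum_(j < N) k ord0 j *:
    (mul_op (f j.+1) : C^oo(M) -> C^oo(M))) 1 (gamma t)); last by rewrite rel.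
  elim/big_rec2: _ => // j D q _ ->.
  by rewrite -[RHS]/(k ord0 j * (f j.+1 (gamma t) * 1) + D 1 (gamma t)) mulr1.
have grad0 t c : chart_dom (charts c) (gamma t) ->
    gradient g (h i) c (gamma t) = 0.
  move=> cgt; have [a Lca ga] := La c.
  have [sym _ _] := Lca.
  apply: (carre_eq0_gradient cgt (sym _ cgt) (ga _ cgt)).
  by rewrite -(double_commutator_carre _ _ Lca cgt); exact: phi0.
have gammaE := gradient_flow_constant flow grad0.
have gammacst : gamma = cst (gamma 0) by apply/funext => t; exact: gammaE.
have limE (G : set_system R) p : ProperFilter G ->
    gamma t @[t --> G] --> p -> gamma 0 = p.
  move=> PG; rewrite gammacst => Gp.
  by apply: (cvg_unique (manifold_hausdorff (M := M)) (@cvg_cst _ _ _ G _) Gp).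
by apply: xy; rewrite -(limE _ _ _ gx) -(limE _ _ _ gy).
Qed.
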